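(* Let $F$ be an algebraically closed field of characteristic different from $2$. Any finite-dimensional involution simple superalgebra over $F$ is isomorphic (as a superalgebra with superinvolution) to one of the following: (1) $R=M_{n,m}(F)$ with the orthosymplectic or transpose superinvolution; (2) $R=M_{n,m}(F)\oplus M_{n,m}(F)^{sop}$ with the exchange superinvolution; (3) $R=Q(n)\oplus Q(n)^{sop}$ with the exchange superinvolution.
   Context: All algebras are associative. A superalgebra is an associative algebra $R$ with a $\mathbb{Z}_2$-grading $R=R_{\bar 0}\oplus R_{\bar 1}$; $|x|$ denotes the degree of a homogeneous $x$. All ideals and homomorphisms are $\mathbb{Z}_2$-graded. A superinvolution on $R$ is a $\mathbb{Z}_2$-graded linear map $*:R\to R$ with $(x^* )^*=x$ for all $x$ and $(xy)^*=(-1)^{|x||y|}y^*x^*$ for homogeneous $x,y$. A superalgebra with superinvolution $(R,* )$ is involution simple if $R^2\neq\{0\}$ and $R$ has no $\mathbb{Z}_2$-graded ideals stable under $*$ other than $0$ and $R$. Superalgebras with superinvolution $(R,* )$ and $(S,\dagger)$ are isomorphic if there is an isomorphism of superalgebras $\varphi:R\to S$ with $\varphi(x^* )=\varphi(x)^\dagger$ for all $x\in R$. $M_{n,m}(F)$ is the matrix algebra $M_{n+m}(F)$ whose even part is the block-diagonal matrices (blocks of sizes $n$, $m$) and whose odd part is the block-off-diagonal matrices. $Q(n)$ is the superalgebra $A=B\oplus tB$, $B\cong M_n(F)$, $t$ commuting with $B$, $t^2=1$, with even part $B$ and odd part $tB$. The orthosymplectic superinvolution is defined on $M_{r,2s}(F)$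 by $$\begin{pmatrix}X&Y\\Z&T\end{pmatrix}^{osp}=\begin{pmatrix}I_r&0\\0&Q\end{pmatrix}^{-1}\begin{pmatrix}X&-Y\\Z&T\end{pmatrix}^{t}\begin{pmatrix}I_r&0\\0&Q\end{pmatrix},\qquad Q=\begin{pmatrix}0&I_s\\-I_s&0\end{pmatrix},$$ where $t$ is the usual transpose. The transpose superinvolution is defined on $M_{r,r}(F)$ by $$\begin{pmatrix}X&Y\\Z&T\end{pmatrix}^{trp}=\begin{pmatrix}T^t&-Y^t\\Z^t&X^t\end{pmatrix}.$$ (So the orthosymplectic case of (1) requires $m$ even, and the transpose case requires $n=m$.) For a superalgebra $A$, $A^{sop}$ is the same $\mathbb{Z}_2$-graded vector space with product $a\circ b=(-1)^{|a||b|}ba$ for homogeneous $a,b$; on the direct sum of ideals $A\oplus A^{sop}$, with elements written as pairs, the exchange superinvolution is $(a,b)\mapsto(b,a)$. *)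

(* Defs.v *)
From HB Require Import structures.
From mathcomp Require Import all_boot all_order all_algebra.

Set Implicit Arguments.
Unset Strict Implicit.
Unset Printing Implicit Defensive.

Import GRing.Theory.
Local Open Scope ring_scope.

Declare Scope superalg_scope.
Delimit Scope superalg_scope with SA.
Local Open Scope superalg_scope.

(* Finite-dimensional associative superalgebras over F.  No unit element is
   assumed, which is why the unital falgType hierarchy is not used.  The group
   Z_2 is (bool, addb): sgrade false is the even part, sgrade true the odd
   one. *)
Record superalgebra (F : fieldType) := Superalgebra {
  scarrier :> vectType F;
  smul : scarrier -> scarrier -> scarrier;
  sgrade : bool -> {vspace scarrier};
  smul_linearr : forall x, linear (smul x);
  smul_linearl : forall y, linear (smul^~ y);
  smulA : associative smul;
  sgrade_direct : directv (sgrade false + sgrade true);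
  sgrade_full : (sgrade false + sgrade true)%VS = fullv;
  sgrade_mul : forall i j x y, x \in sgrade i -> y \in sgrade j ->
    smul x y \in sgrade (i (+) j)
}.
Arguments smul {F s} x y.
Arguments sgrade {F} s i.

Notation "x ** y" := (smul x y) (at level 40, left associativity)
  : superalg_scope.

Definition is_superinvolution (F : fieldType) (A : superalgebra F)
    (star : A -> A) : Prop :=
  [/\ linear star,
      forall i x, x \in sgrade A i -> star x \in sgrade A i,
      forall x, star (star x) = x
    & forall i j x y, x \in sgrade A i -> y \in sgrade A j ->
        star (x ** y) = (-1) ^+ (i && j) *: (star y ** star x)].

Record invsuperalgebra (F : fieldType) := InvSuperalgebra {
  isalg :> superalgebra F;
  istar : isalg -> isalg;
  istarP : is_superinvolution istar
}.
Arguments istar {F} i x.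

Definition graded_ideal (F : fieldType) (A : superalgebra F)
    (I : {vspace A}) : Prop :=
  [/\ (forall x y : A, y \in I -> x ** y \in I),
      (forall x y : A, x \in I -> x ** y \in I)
    & I = (I :&: sgrade A false + I :&: sgrade A true)%VS].

Definition involution_simple (F : fieldType) (R : invsuperalgebra F) : Prop :=
  ~ (forall x y : R, x ** y = 0) /\
  (forall I : {vspace R}, graded_ideal I ->
     (forall x, x \in I -> istar R x \in I) -> I = 0%VS \/ I = fullv).

Definition involution_isomorphic (F : fieldType) (R S : invsuperalgebra F)
    : Prop :=
  exists phi : {linear R -> S},
    [/\ bijective phi,
        forall x y, phi (x ** y) = phi x ** phi y,
        forall i x, x \in sgrade R i -> phi x \in sgrade S i
      & forall x, phi (istar R x) = istar S (phi x)].

Notation "R ~=* S" := (involution_isomorphic R S) (at level 70)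
  : superalg_scope.

Section HomogeneousComponents.
Variables (F : fieldType) (A : superalgebra F).
Implicit Types (x y : A) (i j : bool).

Definition scomp i : 'End(A) := daddv_pi (sgrade A i) (sgrade A (~~ i)).

Lemma sgrade_cap i : (sgrade A i :&: sgrade A (~~ i))%VS = 0%VS.
Proof.
have /directv_addP h := sgrade_direct A.
by case: i => //=; rewrite capvC.
Qed.

Lemma scomp_mem i x : scomp i x \in sgrade A i.
Proof. exact: memv_pi. Qed.

Lemma scomp_id i x : x \in sgrade A i -> scomp i x = x.
Proof. by move=> xi; apply: daddv_pi_id; rewrite ?sgrade_cap. Qed.

Lemma scomp_add i x : scomp i x + scomp (~~ i) x = x.
Proof.
rewrite /scomp negbK; apply: daddv_pi_add; first exact: sgrade_cap.
by case: i => /=; rewrite 1?[(sgrade A true + _)%VS]addvC sgrade_full memvf.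
Qed.

Lemma scomp_other i x : x \in sgrade A i -> scomp (~~ i) x = 0.
Proof.
move=> xi; have := scomp_add i x; rewrite (scomp_id xi).
by move=> /(canRL (addKr x)) ->; rewrite addNr.
Qed.

Lemma homog_ind (P : A -> Prop) :
    (forall x y, P x -> P y -> P (x + y)) ->
    (forall i x, x \in sgrade A i -> P x) -> forall x, P x.
Proof.
move=> hD hH x; rewrite -(scomp_add false x).
by apply: hD; apply: hH; apply: scomp_mem.
Qed.

Lemma smulDr x y z : x ** (y + z) = x ** y + x ** z.
Proof. by have := smul_linearr x 1 y z; rewrite !scale1r. Qed.
Lemma smulDl x y z : (x + y) ** z = x ** z + y ** z.
Proof. by have := smul_linearl z 1 x y; rewrite /= !scale1r. Qed.
Lemma smul0r x : x ** 0 = 0.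
Proof. by apply: (addrI (x ** 0)); rewrite -smulDr !addr0. Qed.
Lemma smul0l x : 0 ** x = 0.
Proof. by apply: (addrI (0 ** x)); rewrite -smulDl !addr0. Qed.
Lemma smulZr x a y : x ** (a *: y) = a *: (x ** y).
Proof. by have := smul_linearr x a y 0; rewrite !addr0 smul0r addr0. Qed.
Lemma smulZl x a y : (a *: x) ** y = a *: (x ** y).
Proof. by have := smul_linearl y a x 0; rewrite /= !addr0 smul0l addr0. Qed.

End HomogeneousComponents.

Section Sop.
Variables (F : fieldType) (A : superalgebra F).
Implicit Types (x y : A) (i j : bool).

(* Bilinear extension of the rule (-1)^(|x||y|) y x for homogeneous x, y. *)
Definition sop_mul x y : A :=
  \sum_(i : bool) \sum_(j : bool)
     (-1) ^+ (i && j) *: (scomp A j y ** scomp A i x).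

Lemma sop_mulE i j x y : x \in sgrade A i -> y \in sgrade A j ->
  sop_mul x y = (-1) ^+ (i && j) *: (y ** x).
Proof.
move=> xi yj; rewrite /sop_mul (bigD1 i) //= (bigD1 j) //=.
rewrite (scomp_id xi) (scomp_id yj) big1 ?addr0 => [|k /negPf nkj]; last first.
  have -> : k = ~~ j by case: k j nkj {yj} => [] [].
  by rewrite (scomp_other yj) smul0l scaler0.
rewrite big1 ?addr0 // => k /negPf nki; rewrite big1 // => l _.
have -> : k = ~~ i by case: k i nki {xi} => [] [].
by rewrite (scomp_other xi) smul0r scaler0.
Qed.

Lemma sop_mul_linearr x : linear (sop_mul x).
Proof.
move=> a u v; rewrite /sop_mul scaler_sumr -big_split /=.
apply: eq_bigr => i _; rewrite scaler_sumr -big_split /=.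
apply: eq_bigr => j _.
by rewrite linearP smulDl smulZl scalerDr !scalerA mulrC.
Qed.

Lemma sop_mul_linearl y : linear (sop_mul^~ y).
Proof.
move=> a u v; rewrite /sop_mul scaler_sumr -big_split /=.
apply: eq_bigr => i _; rewrite scaler_sumr -big_split /=.
apply: eq_bigr => j _.
by rewrite linearP smulDr smulZr scalerDr !scalerA mulrC.
Qed.

Lemma sop_mul_grade i j x y : x \in sgrade A i -> y \in sgrade A j ->
  sop_mul x y \in sgrade A (i (+) j).
Proof.
by move=> xi yj; rewrite (sop_mulE xi yj) memvZ // addbC sgrade_mul.
Qed.

Lemma sop_mulA : associative sop_mul.
Proof.
have Dr x y z : sop_mul x (y + z) = sop_mul x y + sop_mul x z.
  by have := sop_mul_linearr x 1 y z; rewrite !scale1r.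
have Dl x y z : sop_mul (x + y) z = sop_mul x z + sop_mul y z.
  by have := sop_mul_linearl z 1 x y; rewrite /= !scale1r.
move=> x y z; elim/homog_ind: x => [x x' hx hx'|i x xi].
  by rewrite !Dl hx hx'.
elim/homog_ind: y => [y y' hy hy'|j y yj]; first by rewrite !(Dl, Dr) hy hy'.
elim/homog_ind: z => [z z' hz hz'|k z zk]; first by rewrite !Dr hz hz'.
rewrite (sop_mulE xi (sop_mul_grade yj zk)) (sop_mulE yj zk).
rewrite (sop_mulE (sop_mul_grade xi yj) zk) (sop_mulE xi yj).
rewrite smulZl smulZr !scalerA -!signr_addb smulA.
by congr (_ *: _); congr (_ ^+ _); case: i j k {xi yj zk} => [] [] [].
Qed.

Definition sop : superalgebra F :=
  @Superalgebra F A sop_mul (sgrade A) sop_mul_linearr sop_mul_linearl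
    sop_mulA (sgrade_direct A) (sgrade_full A) sop_mul_grade.

End Sop.

Section DirectSum.
Variables (F : fieldType) (A B : superalgebra F).
Let V : vectType F := (A * B)%type.

Definition dsum_mul (u v : V) : V := (u.1 ** v.1, u.2 ** v.2).

Definition dsum_grade i : {vspace V} :=
  (linfun (fst : V -> A) @^-1: sgrade A i :&:
   linfun (snd : V -> B) @^-1: sgrade B i)%VS.

Lemma mem_dsum_grade i u :
  (u \in dsum_grade i) = (u.1 \in sgrade A i) && (u.2 \in sgrade B i).
Proof. by rewrite memv_cap -!memv_preim !lfunE. Qed.

Lemma dsum_mul_linearr x : linear (dsum_mul x).
Proof. by move=> a u v; congr pair; apply: smul_linearr. Qed.

Lemma dsum_mul_linearl y : linear (dsum_mul^~ y).
Proof. by move=> a u v; congr pair; apply: smul_linearl. Qed.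

Lemma dsum_mulA : associative dsum_mul.
Proof. by move=> x y z; rewrite /dsum_mul /= !smulA. Qed.

Lemma dsum_direct : directv (dsum_grade false + dsum_grade true).
Proof.
apply/directv_addP/eqP; rewrite -subv0; apply/subvP => -[a b].
rewrite memv_cap !mem_dsum_grade memv0 /=.
case/andP=> /andP[a0 b0] /andP[a1 b1].
have := scomp_id a0; rewrite (scomp_other a1) => <-.
by have := scomp_id b0; rewrite (scomp_other b1) => <-.
Qed.

Lemma dsum_full : (dsum_grade false + dsum_grade true)%VS = fullv.
Proof.
apply/eqP; rewrite eqEsubv subvf; apply/subvP => -[a b] _.
rewrite -(scomp_add false a) -(scomp_add false b).
have -> (x y : A) (z t : B) : (x + y, z + t) = (x, z) + (y, t) :> V by [].
by apply: memv_add; rewrite mem_dsum_grade /= !scomp_mem.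
Qed.

Lemma dsum_mul_grade i j x y : x \in dsum_grade i -> y \in dsum_grade j ->
  dsum_mul x y \in dsum_grade (i (+) j).
Proof.
rewrite !mem_dsum_grade => /andP[x1 x2] /andP[y1 y2].
by rewrite !sgrade_mul.
Qed.

Definition dsum : superalgebra F :=
  Superalgebra dsum_mul_linearr dsum_mul_linearl dsum_mulA
    dsum_direct dsum_full dsum_mul_grade.

End DirectSum.

Section Exchange.
Variables (F : fieldType) (A : superalgebra F).

Definition exchange_star (u : dsum A (sop A)) : dsum A (sop A) := (u.2, u.1).

Lemma exchange_starP : is_superinvolution exchange_star.
Proof.
split=> //.
- by move=> i x; rewrite !mem_dsum_grade /= andbC.
- by case.
move=> i j [a b] [c d]; rewrite !mem_dsum_grade /=.
case/andP=> ai bi /andP[cj dj].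
congr pair.
  by change (@sop_mul F A b d = (-1) ^+ (i && j) *: @smul F A d b);
    rewrite (sop_mulE bi dj).
change (a ** c = (-1) ^+ (i && j) *: sop_mul c a).
by rewrite (sop_mulE cj ai) scalerA -signr_addb [j && i]andbC addbb scale1r.
Qed.

Definition exchange : invsuperalgebra F := InvSuperalgebra exchange_starP.

End Exchange.

Section Matrices.
Variables (F : fieldType) (n m : nat).
Let V : vectType F := 'M[F]_(n + m).

(* Even: both off-diagonal blocks vanish; odd: both diagonal blocks vanish. *)
Definition Mat_grade (i : bool) : {vspace V} :=
  if i then
    (lker (linfun (lsubmx \o usubmx : V -> 'M[F]_(n, n))) :&:
     lker (linfun (rsubmx \o dsubmx : V -> 'M[F]_(m, m))))%VS
  else
    (lker (linfun (rsubmx \o usubmx : V -> 'M[F]_(n, m))) :&: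
     lker (linfun (lsubmx \o dsubmx : V -> 'M[F]_(m, n))))%VS.

Lemma mem_Mat_grade i (x : V) : (x \in Mat_grade i) =
  if i then (ulsubmx x == 0) && (drsubmx x == 0)
  else (ursubmx x == 0) && (dlsubmx x == 0).
Proof. by case: i; rewrite memv_cap !memv_ker !lfunE. Qed.

Lemma Mat_gradeP i (x : V) : reflect
  (if i then x = block_mx 0 (ursubmx x) (dlsubmx x) 0
   else x = block_mx (ulsubmx x) 0 0 (drsubmx x)) (x \in Mat_grade i).
Proof.
rewrite mem_Mat_grade; have e := submxK x.
by case: i; apply: (iffP andP) => [[/eqP h1 /eqP h2]|->];
  rewrite ?(block_mxKul, block_mxKur, block_mxKdl, block_mxKdr) ?eqxx //;
  rewrite -{1}e h1 h2.
Qed.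

Definition Mat_mul (x y : V) : V := x *m y.

Lemma Mat_mul_linearr x : linear (Mat_mul x).
Proof. by move=> a u v; rewrite /Mat_mul mulmxDr scalemxAr. Qed.

Lemma Mat_mul_linearl y : linear (Mat_mul^~ y).
Proof. by move=> a u v; rewrite /Mat_mul mulmxDl scalemxAl. Qed.

Lemma Mat_mulA : associative Mat_mul.
Proof. by move=> x y z; apply: mulmxA. Qed.

Lemma Mat_direct : directv (Mat_grade false + Mat_grade true).
Proof.
apply/directv_addP/eqP; rewrite -subv0; apply/subvP => x.
rewrite memv_cap !mem_Mat_grade memv0.
case/andP=> /andP[/eqP ur0 /eqP dl0] /andP[/eqP ul0 /eqP dr0].
by rewrite -[x]submxK ul0 ur0 dl0 dr0 block_mx0.
Qed.

Lemma Mat_full : (Mat_grade false + Mat_grade true)%VS = fullv.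
Proof.
apply/eqP; rewrite eqEsubv subvf; apply/subvP => x _.
have -> : x = block_mx (ulsubmx x) 0 0 (drsubmx x) +
              block_mx 0 (ursubmx x) (dlsubmx x) 0 :> V.
  by rewrite add_block_mx !(addr0, add0r) submxK.
apply: memv_add; rewrite mem_Mat_grade.
  by rewrite block_mxKur block_mxKdl !eqxx.
by rewrite block_mxKul block_mxKdr !eqxx.
Qed.

Lemma Mat_mul_grade i j x y : x \in Mat_grade i -> y \in Mat_grade j ->
  Mat_mul x y \in Mat_grade (i (+) j).
Proof.
rewrite /Mat_mul; move=> /Mat_gradeP hx /Mat_gradeP hy.
by case: i j hx hy => [] [] -> ->; rewrite mulmx_block mem_Mat_grade /=
  !(block_mxKul, block_mxKur, block_mxKdl, block_mxKdr);
  rewrite !(mulmx0, mul0mx, addr0) !eqxx.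
Qed.

Definition Mat : superalgebra F :=
  Superalgebra Mat_mul_linearr Mat_mul_linearl Mat_mulA
    Mat_direct Mat_full Mat_mul_grade.

End Matrices.

Section Orthosymplectic.
Variables (F : fieldType) (r s : nat).

Definition symp_mx : 'M[F]_(s + s) := block_mx 0 1%:M (- 1%:M) 0.

Definition osp_form : 'M[F]_(r + (s + s)) := block_mx 1%:M 0 0 symp_mx.

Definition osp_star (x : Mat F r (s + s)) : Mat F r (s + s) :=
  invmx osp_form *m
    (block_mx (ulsubmx x) (- ursubmx x) (dlsubmx x) (drsubmx x))^T *m
  osp_form.

Lemma symp_mx_sqr : symp_mx *m symp_mx = - 1%:M.
Proof.
rewrite /symp_mx mulmx_block !(mul0mx, mulmx0, add0r, addr0).
rewrite !(mulmxN, mulNmx, mul1mx) ?oppr0.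
by rewrite [in RHS](scalar_mx_block s s 1) opp_block_mx !oppr0.
Qed.

Lemma symp_mxT : symp_mx^T = - symp_mx.
Proof.
rewrite /symp_mx tr_block_mx opp_block_mx !trmx0 !oppr0 linearN /= !trmx1.
by rewrite opprK.
Qed.

Lemma osp_formK : invmx osp_form = block_mx 1%:M 0 0 (- symp_mx).
Proof.
have h : block_mx 1%:M 0 0 (- symp_mx) *m osp_form = 1%:M.
  rewrite mulmx_block !(mul0mx, mulmx0, add0r, addr0, mul1mx).
  by rewrite mulNmx symp_mx_sqr opprK -scalar_mx_block.
have [_ u] := mulmx1_unit h.
by rewrite -[RHS]mulmx1 -(mulmxV u) mulmxA h mul1mx.
Qed.

Lemma osp_starE (x : Mat F r (s + s)) :
  osp_star x = block_mx (ulsubmx x)^T ((dlsubmx x)^T *m symp_mx)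
                        (symp_mx *m (ursubmx x)^T)
                        (- symp_mx *m (drsubmx x)^T *m symp_mx).
Proof.
rewrite /osp_star osp_formK tr_block_mx !mulmx_block.
rewrite !(mul0mx, mulmx0, add0r, addr0, mul1mx, mulmx1).
by rewrite linearN /= mulmxN mulNmx opprK.
Qed.

Lemma osp_starP : is_superinvolution osp_star.
Proof.
split.
- move=> a u v; rewrite !osp_starE scale_block_mx add_block_mx.
  rewrite /ulsubmx /ursubmx /dlsubmx /drsubmx !linearP /=.
  by rewrite !(mulmxDl, mulmxDr) -!(scalemxAl, scalemxAr).
- move=> i x /Mat_gradeP hx; rewrite mem_Mat_grade osp_starE.
  rewrite !(block_mxKul, block_mxKur, block_mxKdl, block_mxKdr).
  by case: i hx => ->;
    rewrite !(block_mxKul, block_mxKur, block_mxKdl, block_mxKdr);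
    rewrite !(trmx0, mulmx0, mul0mx) !eqxx.
- move=> x; rewrite !osp_starE.
  rewrite !(block_mxKul, block_mxKur, block_mxKdl, block_mxKdr).
  rewrite !mulNmx linearN /= !trmx_mul !trmxK symp_mxT.
  rewrite !(mulNmx, mulmxN) !opprK !mulmxA symp_mx_sqr -!mulmxA symp_mx_sqr.
  by rewrite !(mulNmx, mulmxN, mul1mx, mulmx1, opprK) submxK.
move=> i j x y /Mat_gradeP hx /Mat_gradeP hy.
change (osp_star (x *m y) = (-1) ^+ (i && j) *: (osp_star y *m osp_star x)).
rewrite !osp_starE.
have sK k (z : 'M[F]_(s + s, k)) : symp_mx *m (symp_mx *m z) = - z.
  by rewrite mulmxA symp_mx_sqr mulNmx mul1mx.
move: symp_mx sK => J sK.
case: i j hx hy => [] [] -> -> /=;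
  rewrite ?expr0 ?expr1 ?scale1r ?scaleN1r !mulmx_block;
  rewrite !(block_mxKul, block_mxKur, block_mxKdl, block_mxKdr);
  rewrite !(mulmx0, mul0mx, add0r, addr0, trmx0, oppr0) ?trmx_mul -?mulmxA;
  by rewrite ?opp_block_mx ?(sK, mulNmx, mulmxN, opprK, oppr0) //.
Qed.

Definition Mat_osp : invsuperalgebra F := InvSuperalgebra osp_starP.

End Orthosymplectic.

Section TransposeSuperinvolution.
Variables (F : fieldType) (r : nat).

Definition trp_star (x : Mat F r r) : Mat F r r :=
  block_mx (drsubmx x)^T (- (ursubmx x)^T) (dlsubmx x)^T (ulsubmx x)^T.

Lemma trp_starP : is_superinvolution trp_star.
Proof.
split.
- move=> a u v; rewrite /trp_star scale_block_mx add_block_mx.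
  rewrite /ulsubmx /ursubmx /dlsubmx /drsubmx.
  by rewrite !linearP /= ?opprD ?scalerN.
- move=> i x /Mat_gradeP hx; rewrite mem_Mat_grade /trp_star.
  rewrite !(block_mxKul, block_mxKur, block_mxKdl, block_mxKdr).
  by case: i hx => ->;
    rewrite !(block_mxKul, block_mxKur, block_mxKdl, block_mxKdr);
    rewrite !(trmx0, oppr0) !eqxx.
- move=> x; rewrite /trp_star.
  rewrite !(block_mxKul, block_mxKur, block_mxKdl, block_mxKdr).
  by rewrite linearN /= !trmxK opprK submxK.
move=> i j x y /Mat_gradeP hx /Mat_gradeP hy.
change (trp_star (x *m y) = (-1) ^+ (i && j) *: (trp_star y *m trp_star x)).
rewrite /trp_star.
case: i j hx hy => [] [] -> -> /=;
  rewrite ?expr0 ?expr1 ?scale1r ?scaleN1r !mulmx_block;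
  rewrite !(block_mxKul, block_mxKur, block_mxKdl, block_mxKdr);
  rewrite !(mulmx0, mul0mx, add0r, addr0, trmx0, oppr0) ?trmx_mul;
  by rewrite ?opp_block_mx ?(mulNmx, mulmxN, opprK, oppr0) //.
Qed.

Definition Mat_trp : invsuperalgebra F := InvSuperalgebra trp_starP.

End TransposeSuperinvolution.

Section Queer.
Variables (F : fieldType) (n : nat).
Let V : vectType F := ('M[F]_n * 'M[F]_n)%type.

(* The pair (a, b) stands for a + t b, with t central and t^2 = 1. *)
Definition Queer_mul (x y : V) : V :=
  (x.1 *m y.1 + x.2 *m y.2, x.1 *m y.2 + x.2 *m y.1).

Definition Queer_grade (i : bool) : {vspace V} :=
  if i then lker (linfun (fst : V -> 'M[F]_n))
  else lker (linfun (snd : V -> 'M[F]_n)).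

Lemma mem_Queer_grade i x :
  (x \in Queer_grade i) = if i then x.1 == 0 else x.2 == 0.
Proof. by case: i; rewrite memv_ker lfunE. Qed.

Lemma Queer_mul_linearr x : linear (Queer_mul x).
Proof.
move=> a u v; rewrite /Queer_mul; congr pair => /=;
  by rewrite !mulmxDr -!scalemxAr scalerDr addrACA.
Qed.

Lemma Queer_mul_linearl y : linear (Queer_mul^~ y).
Proof.
move=> a u v; rewrite /Queer_mul; congr pair => /=;
  by rewrite !mulmxDl -!scalemxAl scalerDr addrACA.
Qed.

Lemma Queer_mulA : associative Queer_mul.
Proof.
move=> x y z; rewrite /Queer_mul; congr pair => /=;
  rewrite !mulmxDl !mulmxDr !mulmxA -!addrA; congr (_ + _);
  by rewrite addrA addrC.
Qed.

Lemma Queer_direct : directv (Queer_grade false + Queer_grade true).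
Proof.
apply/directv_addP/eqP; rewrite -subv0; apply/subvP => -[a b].
by rewrite memv_cap !mem_Queer_grade memv0 /= => /andP[/eqP-> /eqP->].
Qed.

Lemma Queer_full : (Queer_grade false + Queer_grade true)%VS = fullv.
Proof.
apply/eqP; rewrite eqEsubv subvf; apply/subvP => -[a b] _.
have -> : (a, b) = (a, 0) + (0, b) :> V by congr pair; rewrite ?addr0 ?add0r.
by apply: memv_add; rewrite mem_Queer_grade.
Qed.

Lemma Queer_mul_grade i j x y : x \in Queer_grade i -> y \in Queer_grade j ->
  Queer_mul x y \in Queer_grade (i (+) j).
Proof.
case: x y => [a b] [c d]; rewrite !mem_Queer_grade /Queer_mul.
by case: i j => [] [] /= /eqP-> /eqP->; rewrite !(mulmx0, mul0mx, addr0).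
Qed.

Definition Queer : superalgebra F :=
  Superalgebra Queer_mul_linearr Queer_mul_linearl Queer_mulA
    Queer_direct Queer_full Queer_mul_grade.

End Queer.

(* Main.v *)
(* Let e be an even idempotent generating a minimal graded left ideal V = Re.
   Its corner eRe is a graded division algebra over a closed field, hence F e
   or F e + F t with t odd and t^2 = e, and the pairing eR x V -> eRe yields
   matrix units, so that R acts on V through a surjection rho onto M_{n,m}(F)
   or Q(n).  As R is involution simple, ker rho meets its image under the
   superinvolution trivially: if ker rho <> 0 then x |-> (rho x, rho x^* ) is
   an isomorphism onto the exchange superalgebra.  If rho is injective, Q(n) is
   excluded since it carries no superinvolution, and e^* R e is a line F u with
   u homogeneous; x^* y = b(x, y) u then defines a nondegenerate form on V whose
   adjoint is the superinvolution.  A canonical basis for b gives the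
   orthosymplectic (u even) or the transpose (u odd) superinvolution. *)
From HB Require Import structures.
Require Import Defs.
From Stdlib Require Import Classical.
From mathcomp Require Import all_boot all_order all_algebra.

Set Implicit Arguments.
Unset Strict Implicit.
Unset Printing Implicit Defensive.

Import GRing.Theory.
Local Open Scope ring_scope.
Local Open Scope superalg_scope.

(** * Linear algebra and bilinear forms *)

(** Without a unit, the idempotent has to be produced: a nonzero product together with involution
    simplicity makes R semiprime, and a minimal graded left ideal whose square is nonzero contains
    one. The other obstacle is a sign. The generator u satisfies u^* = u or u^* = - u, and in the
    second case an even form b is symmetric on the odd part of Re and skew on the even part, the
    reverse of what the orthosymplectic superinvolution expects. The grading of M_{n,m} depends only
    on whether two basis vectors have equal parity, so the sign is absorbed by letting the first
    block consist of the vectors of parity [flip], even or odd. Characteristic different from 2 is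
    used three times: for a vector with b x x nonzero when b is symmetric, for b x x = 0 when b is
    skew, and for the contradiction 1 = -1 on Q(n). *)

Section LinearAlgebra.
Variable F : fieldType.

Lemma linear_map_of (U V : lmodType F) (f : U -> V) :
  linear f -> exists g : {linear U -> V}, g =1 f.
Proof.
move=> lf; pose l := GRing.isLinear.Build F U V *:%R f lf.
by exists (HB.pack_for {linear U -> V} f l).
Qed.

Lemma linear_bijective (U V : vectType F) (f : {linear U -> V}) :
  (forall x, f x = 0 -> x = 0) -> (forall y, exists x, f x = y) -> bijective f.
Proof.
move=> inj surj.
have k0 : lker (linfun f) == 0%VS.
  rewrite -subv0; apply/subvP => x; rewrite memv_ker lfunE memv0 /=.
  by move=> /eqP/inj ->.
exists (linfun f)^-1%VF => [x|y].
  by have := lker0_lfunK k0 x; rewrite lfunE.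
have [x <-] := surj y.
by have := lker0_lfunK k0 x; rewrite lfunE /= => ->.
Qed.

Lemma dimv_proper (V : vectType F) (U' U : {vspace V}) z :
  (forall y, y \in U' -> y \in U) -> z \in U -> z \notin U' ->
  (\dim U' < \dim U)%N.
Proof.
move=> sub zU zU'; have s : (U' <= U)%VS by apply/subvP => y /sub.
rewrite ltn_neqAle dimvS // andbT; apply: contra zU' => /eqP e.
by have /eqP -> : U' == U by rewrite eqEdim s e leqnn.
Qed.

(** Ideals, annihilators and their sums are handled as linear predicates; a subspace is extracted
    only where a dimension or a basis is needed. *)
Definition linpred (V : lmodType F) (P : V -> Prop) :=
  P 0 /\ forall a x y, P x -> P y -> P (a *: x + y).

Lemma linpredD (V : lmodType F) (P : V -> Prop) x y :
  linpred P -> P x -> P y -> P (x + y).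
Proof. by move=> [_ h] px py; have := h 1 _ _ px py; rewrite scale1r. Qed.

Lemma linpredZ (V : lmodType F) (P : V -> Prop) a x :
  linpred P -> P x -> P (a *: x).
Proof. by move=> [h0 h] px; have := h a _ _ px h0; rewrite addr0. Qed.

(** A subspace inside P that misses a vector of P can be enlarged by that vector, and the dimension
    of V bounds the number of enlargements; excluded middle decides whether a vector is missing. *)
Lemma linpred_vspace (V : vectType F) (P : V -> Prop) :
  linpred P -> exists U : {vspace V}, forall x, x \in U <-> P x.
Proof.
move=> linP.
suff H k (U : {vspace V}) : (\dim {:V} - \dim U <= k)%N ->
    (forall x, x \in U -> P x) ->
    exists U : {vspace V}, forall x, x \in U <-> P x.
  apply: (H (\dim {:V}) 0%VS); first by rewrite leq_subr.
  by move=> x; rewrite memv0 => /eqP ->; case: linP.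
elim: k U => [|k IH] U dU UP.
  exists U => x; split=> [/UP //|_].
  suff -> : U = fullv by rewrite memvf.
  by apply/eqP; rewrite eqEdim subvf /=; move: dU; rewrite leqn0 subn_eq0.
case: (classic (exists x, P x /\ x \notin U)) => [[x [px xU]]|nex].
  apply: (IH (U + <[x]>)%VS).
    have: (\dim U < \dim (U + <[x]>))%N.
      apply: (dimv_proper (z := x)) => // [y yU|].
        by apply: subvP yU; apply: addvSl.
      by rewrite -{1}[x]add0r; apply: memv_add; rewrite ?mem0v ?memv_line.
    move: dU; move: (\dim U) (\dim (U + _)) (\dim _) => a b c.
    rewrite !leq_subLR => h ab; apply: leq_trans h _.
    by rewrite addnS -addSn leq_add2r.
  move=> z /memv_addP[u uU [w /vlineP[a ->] ->]].
  by rewrite addrC; case: linP => _; apply=> //; apply: UP.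
exists U => x; split=> [/UP //|px].
by case xU: (x \in U) => //; case: nex; exists x; rewrite xU.
Qed.

Lemma basis_of_family (V : vectType F) (U : {vspace V}) N (v : 'I_N -> V) :
  (forall i, v i \in U) ->
  (forall x, x \in U -> exists c : 'I_N -> F, x = \sum_i c i *: v i) ->
  (forall c : 'I_N -> F, \sum_i c i *: v i = 0 -> forall i, c i = 0) ->
  basis_of U [tuple v i | i < N].
Proof.
move=> vU vspan vfree; rewrite basisEfree size_tuple.
have e (i : 'I_N) : [tuple v i | i < N]`_i = v i by rewrite -tnth_nth tnth_mktuple.
have fr : free [tuple v i | i < N].
  by apply/freeP => c h i; apply: (vfree c); rewrite -[RHS]h; apply: eq_bigr => j _;
    rewrite e.
rewrite fr /=; apply/andP; split.
  by apply/span_subvP => x /mapP[i _ ->].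
have := fr; rewrite /free size_tuple => /eqP <-; apply: dimvS.
apply/subvP => x /vspan[c ->]; apply: memv_suml => i _; apply/memvZ/memv_span.
by rewrite -e mem_nth ?size_tuple.
Qed.

(** The matrix of the forms on a basis of U has full column rank, because no nontrivial combination
    of them vanishes on U; a left inverse lists the coordinates of the dual vectors. *)
Lemma dual_family (W : vectType F) (U : {vspace W}) N (l : 'I_N -> W -> F) :
  (forall k, scalar (l k)) ->
  (forall c : 'I_N -> F, (forall f, f \in U -> \sum_k c k * l k f = 0) ->
     forall k, c k = 0) ->
  forall j, exists2 f, f \in U & forall k, l k f = (k == j)%:R.
Proof.
move=> lin_l nondeg j.
pose M : 'M[F]_(\dim U, N) := \matrix_(i, k) l k (vbasis U)`_i.
have lsum k m (c : 'I_m -> F) (w : 'I_m -> W) :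
    l k (\sum_i c i *: w i) = \sum_i c i * l k (w i).
  have [g gE] := linear_map_of (lin_l k : linear (l k : W -> F^o)).
  by rewrite -!gE linear_sum; apply: eq_bigr => i _; rewrite linearZ /= gE.
have : row_full M.
  rewrite /row_full -mxrank_tr -/(row_free _); apply: inj_row_free => c cM.
  apply/rowP => k; rewrite mxE; apply: (nondeg (c 0)) => f fU.
  rewrite (coord_vbasis fU).
  under eq_bigr do rewrite lsum mulr_sumr.
  rewrite exchange_big /= big1 // => i _.
  have := congr1 (fun A : 'M_(_, _) => A 0 i) cM; rewrite !mxE => h.
  transitivity (coord (vbasis U) i f * \sum_m c 0 m * M^T m i).
    by rewrite mulr_sumr; apply: eq_bigr => m _; rewrite !mxE mulrCA.
  by rewrite h mulr0.
case/row_fullP => B BM; exists (\sum_i B j i *: (vbasis U)`_i).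
  by apply: memv_suml => i _; apply/memvZ/vbasis_mem/mem_nth; rewrite size_tuple.
move=> k; rewrite lsum eq_sym.
have := congr1 (fun A : 'M_(_, _) => A j k) BM; rewrite !mxE => <-.
by apply: eq_bigr => i _; rewrite mxE.
Qed.

Lemma char2_natr_neq0 : 2%N \notin [pchar F] -> 2%:R != 0 :> F.
Proof. by apply: contra => h; rewrite inE /= h. Qed.

Section Forms.
Variables (V : vectType F) (b : V -> V -> F).
Hypotheses (b_linl : forall y, scalar (b^~ y)) (b_linr : forall x, scalar (b x)).

Lemma bformDl x y z : b (x + y) z = b x z + b y z.
Proof. by have := b_linl z 1 x y; rewrite scale1r /= mul1r. Qed.
Lemma bformDr x y z : b x (y + z) = b x y + b x z.
Proof. by have := b_linr x 1 y z; rewrite scale1r /= mul1r. Qed.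
Lemma bform0l y : b 0 y = 0.
Proof. by apply: (addrI (b 0 y)); rewrite -bformDl !addr0. Qed.
Lemma bform0r y : b y 0 = 0.
Proof. by apply: (addrI (b y 0)); rewrite -bformDr !addr0. Qed.
Lemma bformZl a x y : b (a *: x) y = a * b x y.
Proof. by have := b_linl y a x 0; rewrite /= bform0l !addr0. Qed.
Lemma bformZr a x y : b x (a *: y) = a * b x y.
Proof. by have := b_linr x a y 0; rewrite bform0r !addr0. Qed.
Lemma bform_sumr x N (f : 'I_N -> V) : b x (\sum_i f i) = \sum_i b x (f i).
Proof.
elim: N f => [|N IH] f; first by rewrite !big_ord0 bform0r.
by rewrite !big_ord_recl bformDr IH.
Qed.
Lemma bform_suml y N (f : 'I_N -> V) : b (\sum_i f i) y = \sum_i b (f i) y.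
Proof.
elim: N f => [|N IH] f; first by rewrite !big_ord0 bform0l.
by rewrite !big_ord_recl bformDl IH.
Qed.

Definition nondegenerate_on (U : {vspace V}) :=
  forall x, x \in U -> (forall y, y \in U -> b x y = 0) -> x = 0.

Lemma bform_orth_space (U : {vspace V}) (x : V) :
  exists U' : {vspace V}, forall y, y \in U' <-> y \in U /\ b x y = 0.
Proof.
apply: (@linpred_vspace _ (fun y => y \in U /\ b x y = 0)).
split=> [|a y z [yU xy] [zU xz]]; first by rewrite mem0v bform0r.
by rewrite memvD ?memvZ // bformDr bformZr xy xz mulr0 addr0.
Qed.

End Forms.
End LinearAlgebra.

(** * Eigenvectors and canonical bases over a closed field *)

Section ClosedFields.
Variable F : closedFieldType.

(** U is nonzero, so the characteristic polynomial of g in a basis of U has positive degree and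
    hence a root; a row eigenvector of the matrix lists the coordinates of x. *)
Lemma eigenvector_on (V : vectType F) (U : {vspace V}) (g : V -> V) :
  linear g -> U != 0%VS -> (forall x, x \in U -> g x \in U) ->
  exists2 x, x \in U /\ x != 0 & exists a, g x = a *: x.
Proof.
move=> lin_g U0 gU; have [h hE] := linear_map_of lin_g.
have dU : (0 < \dim U)%N by rewrite lt0n dimv_eq0.
pose X := vbasis U.
pose M : 'M[F]_(\dim U) := \matrix_(i, j) coord X j (g X`_i).
have [a ra] : exists a, root (char_poly M) a.
  by apply/closed_rootP; rewrite size_char_poly; case: (\dim U) dU.
move: ra; rewrite -eigenvalue_root_char => /eigenvalueP[w wM w0].
pose x := \sum_i w 0 i *: X`_i.
have Xi i : X`_(i : 'I_(\dim U)) \in U.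
  by apply/vbasis_mem/mem_nth; rewrite size_tuple.
exists x.
  split; first by apply: memv_suml => i _; apply: memvZ.
  apply: contra w0 => /eqP x0; apply/eqP/rowP => i; rewrite mxE.
  by have /freeP := basis_free (vbasisP U); apply.
exists a; rewrite /x -hE linear_sum scaler_sumr.
transitivity (\sum_i \sum_j (w 0 i * M i j) *: X`_j).
  apply: eq_bigr => i _; rewrite linearZ /= hE.
  rewrite {1}(coord_vbasis (gU _ (Xi i))) scaler_sumr.
  by apply: eq_bigr => j _; rewrite scalerA mxE.
rewrite exchange_big /=; apply: eq_bigr => j _.
rewrite -scaler_suml scalerA; congr (_ *: _).
by have := congr1 (fun A : 'M_(_, _) => A 0 j) wM; rewrite !mxE.
Qed.

Lemma closed_sqrt (a : F) : exists c, c ^+ 2 = a.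
Proof.
have [c] := @solve_monicpoly F 2 (fun i => if i == 0%N then a else 0) isT.
rewrite !big_ord_recl big_ord0 /= expr0 mulr1 mul0r !addr0 => h.
by exists c.
Qed.

End ClosedFields.

Section CanonicalBases.
Variables (F : closedFieldType) (charF : 2%N \notin [pchar F]).
Variables (V : vectType F) (b : V -> V -> F).
Hypotheses (b_linl : forall y, scalar (b^~ y)) (b_linr : forall x, scalar (b x)).

Let bE := (bformDl b_linl, bformDr b_linr, bformZl b_linl, bformZr b_linr).

Let eq_opp_eq0 (a : F) : a = - a -> a = 0.
Proof.
move=> h; apply/eqP; have : 2%:R * a == 0.
  by rewrite mulr_natl mulr2n {1}h addNr.
by rewrite mulf_eq0 (negPf (char2_natr_neq0 charF)).
Qed.

(** Induction on the dimension, splitting off a vector z with b z z = 1: over a closed field any x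
    with b x x nonzero rescales to such a z, and the rest of the basis comes from the orthogonal
    complement. *)
Lemma orthonormal_basis (U : {vspace V}) :
  {in U &, forall x y, b x y = b y x} -> nondegenerate_on b U ->
  exists n (v : 'I_n -> V),
    [/\ forall i, v i \in U,
        forall i j, b (v i) (v j) = (i == j)%:R
      & forall x, x \in U -> x = \sum_i b (v i) x *: v i].
Proof.
have [k] := ubnP (\dim U); elim: k U => [//|k IH] U dU sym nd.
have [U0|/eqP U0] := eqVneq U 0%VS.
  exists 0%N, (fun=> 0); split=> [[]//|[]//|x].
  by rewrite U0 memv0 big_ord0 => /eqP.
have [x0 [x0U bx0]] : exists x, x \in U /\ b x x != 0.
  apply: NNPP => nex; apply: U0; apply/eqP; rewrite -subv0.
  have b0 x : x \in U -> b x x = 0.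
    by move=> xU; apply/eqP/negP => /negP h; apply: nex; exists x.
  apply/subvP => x xU; rewrite memv0; apply/eqP/(nd x xU) => y yU.
  (* Polarization: if b x x vanishes identically on U, expanding b (x + y) (x + y) gives b x y = - b
     y x = - b x y, so b is zero on U. *)
  apply: eq_opp_eq0; have := b0 _ (memvD xU yU).
  rewrite !bE (b0 x) // (b0 y) // add0r addr0 (sym y x) // => /eqP.
  by rewrite addr_eq0 => /eqP.
have [c c2] := closed_sqrt (b x0 x0).
have c0 : c != 0 by apply: contra bx0 => /eqP c0; rewrite -c2 c0 expr0n.
pose z := c^-1 *: x0.
have zU : z \in U by apply: memvZ.
have bzz : b z z = 1.
  by rewrite !bE -c2 expr2 mulKf // mulVf.
clearbody z.
have [U' U'P] := bform_orth_space b_linr U z.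
have proj y : y \in U -> y - b z y *: z \in U'.
  move=> yU; apply/U'P; split; first by rewrite memvB ?memvZ.
  by rewrite -scaleNr !bE bzz mulr1 subrr.
have U'U y : y \in U' -> y \in U by case/U'P.
have [] := IH U'.
- rewrite -ltnS; apply: leq_trans dU; rewrite ltnS; apply: (dimv_proper U'U zU).
  by apply/negP => /U'P[_ /eqP]; rewrite bzz oner_eq0.
- by move=> x y /U'U xU /U'U yU; apply: sym.
- move=> x /U'P[xU zx] h; apply: (nd _ xU) => y yU.
  have := h _ (proj y yU); rewrite -scaleNr !bE (sym x z) // zx mulr0 addr0.
  by [].
move=> n [v [vU vv vspan]].
pose w i := oapp v z (unlift ord0 i).
have w0 : w ord0 = z by rewrite /w unlift_none.
have wS i : w (lift ord0 i) = v i by rewrite /w liftK.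
have zv i : b z (v i) = 0 by have /U'P[] := vU i.
have vz i : b (v i) z = 0 by rewrite sym // U'U.
have l0 N (i : 'I_N) :
    ((lift ord0 i == ord0) = false) * ((ord0 == lift ord0 i) = false).
  by rewrite eq_sym !(negPf (neq_lift _ _)).
exists n.+1, w; split.
- by move=> i; have [j|] := unliftP ord0 i => ->; rewrite ?w0 // wS U'U.
- move=> i j; have [i'|] := unliftP ord0 i => ->;
    have [j'|] := unliftP ord0 j => ->; by rewrite ?w0 ?wS ?zv ?vz ?bzz ?eqxx ?l0 ?vv ?(inj_eq lift_inj).
move=> x xU; rewrite big_ord_recl w0.
rewrite -{1}[x](subrK (b z x *: z)) addrC; congr (_ + _).
rewrite {1}(vspan _ (proj x xU)); apply: eq_bigr => i _.
by rewrite wS -scaleNr !bE vz mulr0 addr0.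
Qed.

(** Induction on the dimension, splitting off a hyperbolic plane spanned by x and y with b x y =
    1. *)
Lemma symplectic_basis (U : {vspace V}) :
  {in U &, forall x y, b x y = - b y x} -> nondegenerate_on b U ->
  exists s (p q : 'I_s -> V),
    [/\ forall i, p i \in U /\ q i \in U,
        forall i j, b (p i) (p j) = 0 /\ b (q i) (q j) = 0,
        forall i j, b (p i) (q j) = (i == j)%:R
      & forall x, x \in U ->
          x = \sum_i (b x (q i) *: p i - b x (p i) *: q i)].
Proof.
have [k] := ubnP (\dim U); elim: k U => [//|k IH] U dU sym nd.
have [U0|/eqP U0] := eqVneq U 0%VS.
  exists 0%N, (fun=> 0), (fun=> 0); split=> [[]//|[]//|[]//|x].
  by rewrite U0 memv0 big_ord0 => /eqP.
have alt x : x \in U -> b x x = 0 by move=> xU; apply: eq_opp_eq0; apply: sym.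
have [x [y [xU yU bxy]]] : exists x y, [/\ x \in U, y \in U & b x y = 1].
  apply: NNPP => nex; apply: U0; apply/eqP; rewrite -subv0.
  apply/subvP => x xU; rewrite memv0; apply/eqP/(nd x xU) => y yU.
  apply/eqP/negP => /negP h; apply: nex; exists x, ((b x y)^-1 *: y).
  by rewrite xU memvZ // !bE mulVf.
have byx : b y x = -1 by rewrite sym // bxy.
have [U1 U1P] := bform_orth_space b_linr U x.
have [U' U'P1] := bform_orth_space b_linr U1 y.
have U'P w : w \in U' <-> [/\ w \in U, b x w = 0 & b y w = 0].
  by rewrite U'P1 U1P; split=> [[[? ?] ?]|[? ? ?]].
(* Projection onto the orthogonal complement of the plane; the signs come from b x y = 1 and b y x =
   -1. *)
pose pr w := w - (b w y *: x - b w x *: y).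
have proj w : w \in U -> pr w \in U'.
  move=> wU; apply/U'P; split; first by rewrite memvB // memvB ?memvZ.
    rewrite /pr opprB -scaleNr !bE (alt x) // bxy mulr0 addr0 mulr1.
    by rewrite (sym w x) // subrr.
  rewrite /pr opprB -scaleNr !bE (alt y) // byx mulr0 add0r mulrN1 opprK.
  by rewrite (sym w y) // subrr.
have U'U w : w \in U' -> w \in U by case/U'P.
have [] := IH U'.
- rewrite -ltnS; apply: leq_trans dU; rewrite ltnS; apply: (dimv_proper U'U xU).
  by apply/negP => /U'P[_ _ /eqP]; rewrite byx oppr_eq0 oner_eq0.
- by move=> u w /U'U uU /U'U wU; apply: sym.
- move=> u /U'P[uU xu yu] h; apply: (nd _ uU) => w wU.
  have := h _ (proj w wU); rewrite /pr opprB -scaleNr !bE.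
  by rewrite (sym u x) // (sym u y) // xu yu oppr0 !mulr0 !addr0.
move=> s [p [q [pqU pq0 pq1 pqspan]]].
pose ext z (v : 'I_s -> V) i := oapp v z (unlift ord0 i).
have e0 z v : ext z v ord0 = z by rewrite /ext unlift_none.
have eS z v i : ext z v (lift ord0 i) = v i by rewrite /ext liftK.
have pU' i : p i \in U' by have [] := pqU i.
have qU' i : q i \in U' by have [] := pqU i.
have orthl w : w \in U' -> (b x w = 0) * (b y w = 0) by case/U'P.
have orthr w : w \in U' -> (b w x = 0) * (b w y = 0).
  move=> wU'; have wU := U'U _ wU'.
  by rewrite (sym w x) // (sym w y) // !orthl // oppr0.
have l0 N (i : 'I_N) :
    ((lift ord0 i == ord0) = false) * ((ord0 == lift ord0 i) = false).
  by rewrite eq_sym !(negPf (neq_lift _ _)).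
exists s.+1, (ext x p), (ext y q); split.
- by move=> i; have [j|] := unliftP ord0 i => ->; rewrite ?e0 // !eS !U'U.
- move=> i j; have [i'|] := unliftP ord0 i => ->;
    have [j'|] := unliftP ord0 j => ->; rewrite ?e0 ?eS ?alt ?orthl ?orthr //.
- move=> i j; have [i'|] := unliftP ord0 i => ->;
    have [j'|] := unliftP ord0 j => ->;
    by rewrite ?e0 ?eS ?bxy ?orthl ?orthr ?eqxx ?l0 ?pq1 ?(inj_eq lift_inj).
move=> w wU; rewrite big_ord_recl !e0.
rewrite -{1}[w](subrK (b w y *: x - b w x *: y)) addrC; congr (_ + _).
rewrite -/(pr w) {1}(pqspan _ (proj w wU)); apply: eq_bigr => i _.
rewrite !eS /pr opprB -scaleNr !bE !orthl // !mulr0 !addr0.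
by [].
Qed.

End CanonicalBases.

(** * Graded ideals of involution simple superalgebras *)

Lemma linpred_sum (F : fieldType) (V : lmodType F) (P : V -> Prop)
    (I : Type) (s : seq I) (f : I -> V) :
  linpred P -> (forall i, P (f i)) -> P (\sum_(i <- s) f i).
Proof.
move=> linP Pf; elim: s => [|i s IH]; first by rewrite big_nil; case: linP.
by rewrite big_cons; apply: linpredD.
Qed.

Section Superalgebra.
Variables (F : fieldType) (A : superalgebra F).
Implicit Types (x y z r : A) (i j k : bool) (P : A -> Prop).

Lemma sgrade_scomp i x : (x \in sgrade A i) = (scomp A (~~ i) x == 0).
Proof.
apply/idP/eqP => [/scomp_other //|x0].
by rewrite -(scomp_add i x) x0 addr0 scomp_mem.
Qed.

Lemma scomp_mulr i k x y : y \in sgrade A k ->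
  scomp A i (x ** y) = scomp A (i (+) k) x ** y.
Proof.
move=> yk; rewrite -{1}(scomp_add (i (+) k) x) smulDl linearD /=.
have := sgrade_mul (scomp_mem (i (+) k) x) yk.
rewrite -addbA addbb addbF => h; rewrite (scomp_id h).
have := sgrade_mul (scomp_mem (~~ (i (+) k)) x) yk.
rewrite addNb -addbA addbb addbF => h'.
by have := scomp_other h'; rewrite negbK => ->; rewrite addr0.
Qed.

Lemma scomp_mull i k x y : x \in sgrade A k ->
  scomp A i (x ** y) = x ** scomp A (i (+) k) y.
Proof.
move=> xk; rewrite -{1}(scomp_add (i (+) k) y) smulDr linearD /=.
have := sgrade_mul xk (scomp_mem (i (+) k) y).
rewrite [k (+) _]addbC -addbA addbb addbF => h; rewrite (scomp_id h).
have := sgrade_mul xk (scomp_mem (~~ (i (+) k)) y).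
rewrite [k (+) _]addbC addNb -addbA addbb addbF => h'.
by have := scomp_other h'; rewrite negbK => ->; rewrite addr0.
Qed.

Lemma smul_suml N (f : 'I_N -> A) y : (\sum_i f i) ** y = \sum_i (f i ** y).
Proof.
elim: N f => [|N IH] f; first by rewrite !big_ord0 smul0l.
by rewrite !big_ord_recl smulDl IH.
Qed.

Lemma smul_sumr N (f : 'I_N -> A) y : y ** (\sum_i f i) = \sum_i (y ** f i).
Proof.
elim: N f => [|N IH] f; first by rewrite !big_ord0 smul0r.
by rewrite !big_ord_recl smulDr IH.
Qed.

Lemma smulNl x y : (- x) ** y = - (x ** y).
Proof. by rewrite -!scaleN1r smulZl. Qed.

Definition graded_pred P := forall i x, P x -> P (scomp A i x).

Definition left_gideal P :=
  [/\ linpred P, graded_pred P & forall r x, P x -> P (r ** x)].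

Definition gideal P :=
  [/\ linpred P, graded_pred P, forall r x, P x -> P (r ** x)
    & forall r x, P x -> P (x ** r)].

Lemma gidealI P P' : gideal P -> gideal P' -> gideal (fun x => P x /\ P' x).
Proof.
move=> [[p0 pl] pg pL pR] [[q0 ql] qg qL qR]; split; first split=> //.
- by move=> a x y [? ?] [? ?]; split; [apply: pl|apply: ql].
- by move=> i x [? ?]; split; [apply: pg|apply: qg].
- by move=> i x [? ?]; split; [apply: pL|apply: qL].
- by move=> i x [? ?]; split; [apply: pR|apply: qR].
Qed.

(** The annihilator is graded because the product of the components x_i and l_k is the component of
    degree i + k of x l_k, which vanishes as l_k lies in P. *)
Lemma annihilator_gideal P : left_gideal P ->
  gideal (fun x => forall l, P l -> x ** l = 0).
Proof.
case=> pl pg pL; split.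
- split=> [l _|a x y hx hy l Pl]; first by rewrite smul0l.
  by rewrite smulDl smulZl hx // hy // scaler0 addr0.
- move=> i x hx l Pl; rewrite -(scomp_add false l) smulDr.
  have e k : scomp A i x ** scomp A k l = 0.
    rewrite -[i](addbK k) -(scomp_mulr _ _ (scomp_mem k l)).
    by rewrite hx ?linear0 //; apply: pg.
  by rewrite !e addr0.
- by move=> r x hx l Pl; rewrite -smulA hx // smul0r.
- by move=> r x hx l Pl; rewrite -smulA hx //; apply: pL.
Qed.

Lemma right_annihilator_gideal P : gideal P ->
  gideal (fun y => forall x, P x -> x ** y = 0).
Proof.
case=> pl pg pL pR; split.
- split=> [l _|a x y hx hy l Pl]; first by rewrite smul0r.
  by rewrite smulDr smulZr hx // hy // scaler0 addr0.
- move=> i y hy x Px; rewrite -(scomp_add false x) smulDl.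
  have e k : scomp A k x ** scomp A i y = 0.
    rewrite -[i](addbK k) -(scomp_mull _ _ (scomp_mem k x)).
    by rewrite hy ?linear0 //; apply: pg.
  by rewrite !e addr0.
- by move=> r y hy x Px; rewrite smulA hy //; apply: pR.
- by move=> r y hy x Px; rewrite smulA hy // smul0l.
Qed.

(** The last clause is minimality of the graded left ideal Ae, phrased without subspaces: every
    nonzero homogeneous element of Ae generates e. *)
Definition primitive e :=
  [/\ e \in sgrade A false, e ** e = e, e != 0
    & forall i x, x \in sgrade A i -> x ** e = x -> x != 0 ->
        exists r, r ** x = e].

(** As x has degree i and e is even, only the component of r of degree i contributes to r x = e;
    multiplying it by e on the left preserves the product because e e = e. *)
Lemma primitiveP e i x : primitive e ->
  x \in sgrade A i -> x ** e = x -> x != 0 ->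
  exists r, [/\ r \in sgrade A i, e ** r = r & r ** x = e].
Proof.
move=> [e0 ee _ h] xi xe x0; have [r re] := h _ _ xi xe x0.
have e' : scomp A i r ** x = e.
  have := scomp_mulr false r xi; rewrite re (scomp_id e0) => ->.
  by rewrite addFb.
exists (e ** scomp A i r); split.
- by rewrite -[i]addFb sgrade_mul ?scomp_mem.
- by rewrite smulA ee.
- by rewrite -smulA e'.
Qed.

End Superalgebra.

(** * Semiprimeness and the primitive idempotent *)

Section InvolutionSimple.
Variables (F : fieldType) (R : invsuperalgebra F).
Implicit Types (x y z r : R) (i j k : bool) (P : R -> Prop).
Notation star := (istar R).

Lemma starZD a x y : star (a *: x + y) = a *: star x + star y.
Proof. by case: (istarP R) => h _ _ _; apply: h. Qed.
Lemma starD x y : star (x + y) = star x + star y.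
Proof. by have := starZD 1 x y; rewrite !scale1r. Qed.
Lemma star0 : star 0 = 0.
Proof. by apply: (addrI (star 0)); rewrite -starD !addr0. Qed.
Lemma starZ a x : star (a *: x) = a *: star x.
Proof. by have := starZD a x 0; rewrite star0 !addr0. Qed.
Lemma star_grade i x : x \in sgrade R i -> star x \in sgrade R i.
Proof. by case: (istarP R) => _ h _ _; apply: h. Qed.
Lemma starK x : star (star x) = x.
Proof. by case: (istarP R). Qed.
Lemma star_mul_homog i j x y : x \in sgrade R i -> y \in sgrade R j ->
  star (x ** y) = (-1) ^+ (i && j) *: (star y ** star x).
Proof. by case: (istarP R) => _ _ _ h; apply: h. Qed.
Lemma star_eq0 x : star x = 0 -> x = 0.
Proof. by move=> h; rewrite -(starK x) h star0. Qed.

Lemma star_scomp i x : star (scomp R i x) = scomp R i (star x).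
Proof.
rewrite -{2}(scomp_add i x) starD linearD /=.
rewrite (scomp_id (star_grade (scomp_mem i x))).
have := scomp_other (star_grade (scomp_mem (~~ i) x)).
by rewrite negbK => ->; rewrite addr0.
Qed.

(** With the bilinearly extended sign rule the superinvolution is a homomorphism into the opposite
    superalgebra, free of homogeneity hypotheses. *)
Lemma star_mul x y : star (x ** y) = sop_mul (star x) (star y).
Proof.
elim/homog_ind: x => [x x' hx hx'|i x xi].
  rewrite smulDl !starD hx hx'.
  by have := sop_mul_linearl (star y) 1 (star x) (star x'); rewrite /= !scale1r.
elim/homog_ind: y => [y y' hy hy'|j y yj].
  rewrite smulDr !starD hy hy'.
  by have := sop_mul_linearr (star x) 1 (star y) (star y'); rewrite !scale1r.
by rewrite (star_mul_homog xi yj) (sop_mulE (star_grade xi) (star_grade yj)).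
Qed.

Lemma gideal_star P : gideal P -> gideal (fun x => P (star x)).
Proof.
case=> pl pg pL pR; split.
- by split=> [|a x y px py]; rewrite ?star0 ?starZD; case: pl => // _; apply.
- by move=> i x px; rewrite star_scomp; apply: pg.
- move=> r x px; rewrite star_mul /sop_mul; do 2!apply: linpred_sum => // ?.
  by apply: linpredZ => //; apply: pR; apply: pg.
- move=> r x px; rewrite star_mul /sop_mul; do 2!apply: linpred_sum => // ?.
  by apply: linpredZ => //; apply: pL; apply: pg.
Qed.

Hypothesis simpleR : involution_simple R.

Lemma simple_gideal P : gideal P -> (forall x, P x -> P (star x)) ->
  (forall x, P x -> x = 0) \/ (forall x, P x).
Proof.
case=> pl pg pL pR pstar; have [U UP] := linpred_vspace pl.
have [_ /(_ U)] := simpleR; case.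
- split.
  + by move=> x y /UP py; apply/UP/pL.
  + by move=> x y /UP px; apply/UP/pR.
  + apply/eqP; rewrite eqEsubv; apply/andP; split; last first.
      by rewrite subv_add !capvSl.
    apply/subvP => x /UP px; rewrite -(scomp_add false x).
    by apply: memv_add; rewrite memv_cap scomp_mem andbT; apply/UP/pg.
- by move=> x /UP px; apply/UP/pstar.
- by move=> U0; left=> x /UP; rewrite U0 memv0 => /eqP.
- by move=> U1; right=> x; apply/UP; rewrite U1 memvf.
Qed.

Lemma gideal_cap_star P : gideal P -> ~ (forall x, P x) ->
  forall x, P x -> P (star x) -> x = 0.
Proof.
move=> idP nfull x px psx.
have [] := simple_gideal (gidealI idP (gideal_star idP)).
- by move=> y [py psy]; rewrite starK.
- by apply.
- by move=> full; case: nfull => y; case: (full y).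
Qed.

Lemma gideal_add_star P : gideal P -> (exists2 x, P x & x <> 0) ->
  forall x, exists y z, [/\ P y, P z & x = y + star z].
Proof.
move=> [pl pg pL pR] [w pw w0].
have [p0 pZD] := pl.
have [sl sg sL sR] := gideal_star (And4 pl pg pL pR).
pose Q x := exists y z, [/\ P y, P z & x = y + star z].
have [||Q0|//] := @simple_gideal Q.
- split.
  + split=> [|a x y]; first by exists 0, 0; rewrite star0 addr0.
    move=> [x1 [x2 [px1 px2 ->]]] [y1 [y2 [py1 py2 ->]]].
    exists (a *: x1 + y1), (a *: x2 + y2); split; [exact: pZD|exact: pZD|].
    by rewrite starZD scalerDr addrACA.
  + move=> i x [y [z [py pz ->]]]; exists (scomp R i y), (scomp R i z).
    by rewrite star_scomp linearD; split=> //; apply: pg.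
  + move=> r x [y [z [py pz ->]]]; exists (r ** y), (star (r ** star z)).
    rewrite starK smulDr; split=> //; first exact: pL.
    by apply: sL; rewrite starK.
  + move=> r x [y [z [py pz ->]]]; exists (y ** r), (star (star z ** r)).
    rewrite starK smulDl; split=> //; first exact: pR.
    by apply: sR; rewrite starK.
- move=> x [y [z [py pz ->]]]; exists z, y.
  by rewrite starD starK addrC.
- by case: w0; apply: Q0; exists w, 0; rewrite star0 addr0.
Qed.

(** If P were nonzero, R would be P + star P. Mixed products lie in both summands and hence vanish,
    P P = 0 by assumption, and products inside star P are, up to signs on components, stars of
    products in P; so every product in R would be zero. *)
Lemma semiprime P : gideal P -> (forall x y, P x -> P y -> x ** y = 0) ->
  forall x, P x -> x = 0.
Proof.
move=> idP sq0 x px; apply: NNPP => x0.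
have [nz _] := simpleR.
have nfull : ~ (forall x, P x) by move=> full; apply: nz => y z; apply: sq0.
have [pl pg pL pR] := idP.
have [_ sg sL sR] := gideal_star idP.
have cap0 := gideal_cap_star idP nfull.
apply: nz => y z.
have [|y1 [y2 [py1 py2 ->]]] := gideal_add_star idP _ y; first by exists x.
have [|z1 [z2 [pz1 pz2 ->]]] := gideal_add_star idP _ z; first by exists x.
rewrite smulDl !smulDr (sq0 _ _ py1 pz1) add0r.
rewrite (cap0 (y1 ** star z2)); [|exact: pR|by apply: sL; rewrite starK].
rewrite add0r (cap0 (star y2 ** z1)); [|exact: pL|by apply: sR; rewrite starK].
rewrite add0r; apply: star_eq0; rewrite star_mul !starK /sop_mul.
by rewrite big1 // => i _; rewrite big1 // => j _; rewrite sq0 ?scaler0 //;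
  apply: pg.
Qed.

(* P is contained in its left annihilator N and in the right annihilator of N;
   the intersection of these two-sided ideals squares to zero. *)
Lemma left_gideal_sqr0 P : left_gideal P ->
  (forall x y, P x -> P y -> x ** y = 0) -> forall x, P x -> x = 0.
Proof.
move=> lidP sq0 x px.
have idN := annihilator_gideal lidP.
have idN' := right_annihilator_gideal idN.
apply: (semiprime (gidealI idN idN')) => [y z [ny ny'] [nz nz']|].
  exact: nz'.
split=> [l pl|y ny]; first exact: sq0.
exact: ny.
Qed.

(** Substitute for a unit: the elements killed by every left multiplication form a left ideal whose
    square is zero. *)
Lemma right_annihilator0 x : (forall r, r ** x = 0) -> x = 0.
Proof.
move=> h; apply: (left_gideal_sqr0 (P := fun x => forall r, r ** x = 0)) => //.
have idT : gideal (fun _ : R => True) by [].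
have [pl pg pL _] := right_annihilator_gideal idT.
split.
- case: pl => p0 pl; split=> [r|a y z hy hz r]; first exact: p0.
  by rewrite (pl a y z) // => ? _.
- by move=> i y hy r; rewrite (pg i y) // => ? _.
- by move=> r y hy r'; rewrite (pL r y) // => ? _.
Qed.

Lemma minimal_left_gideal : exists L : {vspace R},
  [/\ left_gideal (fun x => x \in L), L != 0%VS
    & forall P, left_gideal P -> (forall x, P x -> x \in L) ->
        (exists2 x, P x & x <> 0) -> forall x, x \in L -> P x].
Proof.
pose good (U : {vspace R}) := left_gideal (fun x => x \in U) /\ U != 0%VS.
suff [L [goodL Lmin]] : exists L, good L /\
    forall U, good U -> (\dim L <= \dim U)%N.
  exists L; case: (goodL) => lidL L0; split=> // P lidP PL [x px x0] y yL.
  have [U UP] := linpred_vspace (let: And3 h _ _ := lidP in h).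
  have sUL : (U <= L)%VS by apply/subvP => z /UP/PL.
  have gU : good U.
    split; last first.
      apply/eqP => U0; apply: x0; apply/eqP; rewrite -memv0 -U0; exact/UP.
    case: lidP => pl pg pL; split.
    - by split=> [|a u v uU vU]; rewrite ?mem0v // memvD ?memvZ.
    - by move=> i z /UP pz; apply/UP/pg.
    - by move=> i z /UP pz; apply/UP/pL.
  have /eqP e : U == L by rewrite eqEdim sUL Lmin.
  by apply/UP; rewrite e.
have good1 : good fullv.
  split; first split; try by move=> *; rewrite memvf.
    by split=> *; rewrite memvf.
  apply/eqP => R0; have [nz _] := simpleR; apply: nz => x y.
  by apply/eqP; rewrite -memv0 -R0 memvf.
suff H (k : nat) U : good U -> (\dim U <= k)%N ->
    exists L, good L /\ forall U, good U -> (\dim L <= \dim U)%N.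
  exact: (H _ _ good1 (leqnn _)).
elim: k U => [|k IH] U gU dU.
  by exists U; split=> // U' _; move: dU; rewrite leqn0 => /eqP ->.
case: (classic (exists U', good U' /\ (\dim U' < \dim U)%N)).
  by move=> [U' [gU' lt]]; apply: (IH U') => //; rewrite -ltnS (leq_trans lt).
move=> nex; exists U; split=> // U' gU'; rewrite leqNgt; apply/negP => lt.
by apply: nex; exists U'.
Qed.

(** Graded Brauer lemma. A minimal L has nonzero square, so right multiplication by some homogeneous
    y in L is nonzero on L; by minimality it is bijective on L, and the preimage of y is idempotent.
    A nonzero homogeneous x in Re then generates L, since R x = 0 would force x = 0. *)
Lemma exists_primitive : exists e : R, primitive e.
Proof.
have [L [lidL L0 Lmin]] := minimal_left_gideal.
have [Ll Lg LL] := lidL.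
have Lker z i : z \in sgrade R i ->
    left_gideal (fun x => x \in L /\ x ** z = 0).
  move=> zi; split.
  - split=> [|a u v [uL uz] [vL vz]]; first by rewrite mem0v smul0l.
    by rewrite memvD ?memvZ // smulDl smulZl uz vz scaler0 addr0.
  - move=> j x [xL xz]; split; first exact: Lg.
    by rewrite -[j](addbK i) -(scomp_mulr _ _ zi) xz linear0.
  - by move=> r x [xL xz]; rewrite -smulA xz smul0r; split=> //; apply: LL.
have [i [y [l [yL yi lL ly]]]] : exists i y l,
    [/\ y \in L, y \in sgrade R i, l \in L & l ** y <> 0].
  apply: NNPP => nex; case/eqP: L0; apply/eqP; rewrite -subv0.
  apply/subvP => x xL; rewrite memv0; apply/eqP.
  apply: (left_gideal_sqr0 lidL) xL => u v uL vL.
  have h k : u ** scomp R k v = 0.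
    apply: NNPP => uv; apply: nex; exists k, (scomp R k v), u.
    by split=> //; [apply: Lg|apply: scomp_mem].
  by rewrite -(scomp_add false v) smulDr !h addr0.
have [e' e'L e'y] : exists2 e', e' \in L & e' ** y = y.
  have := @Lmin (fun x => exists2 l, l \in L & l ** y = x); apply=> //.
  - split.
    + split=> [|a u v [u' u'L <-] [v' v'L <-]].
        by exists 0; rewrite ?mem0v ?smul0l.
      by exists (a *: u' + v'); rewrite ?memvD ?memvZ // smulDl smulZl.
    + move=> j x [x' x'L <-]; exists (scomp R (j (+) i) x'); first exact: Lg.
      by rewrite (scomp_mulr _ _ yi).
    + by move=> r x [x' x'L <-]; exists (r ** x'); rewrite ?smulA //; apply: LL.
  - by move=> x [l' l'L <-]; apply: LL.
  - by exists (l ** y) => //; exists l.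
(* As y is homogeneous, comparing components in e' y = y shows that the even part of e' already
   fixes y. *)
pose e := scomp R false e'.
have eL : e \in L by apply: Lg.
have e0 : e \in sgrade R false by apply: scomp_mem.
have ey : e ** y = y.
  rewrite /e -[false](addbb i) -(scomp_mulr _ _ yi) e'y.
  exact: scomp_id.
have ker0 x : x \in L -> x ** y = 0 -> x = 0.
  move=> xL xy; apply: NNPP => x0; apply: ly.
  have := Lmin _ (Lker y i yi) _ _ l lL; case=> //; first by move=> ? [].
  by exists x.
have ee : e ** e = e.
  apply/eqP; rewrite -subr_eq0; apply/eqP/ker0.
    by rewrite memvB //; apply: LL.
  by rewrite smulDl smulNl -smulA !ey subrr.
have en0 : e != 0.
  by apply/eqP => h; apply: ly; rewrite -ey h smul0l smul0r.
exists e; split=> // j x xj xe x0.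
have [] := @Lmin (fun z => exists2 r, True & r ** x = z) _ _ _ e eL.
- split.
  + split=> [|a u v [u' _ <-] [v' _ <-]]; first by exists 0; rewrite ?smul0l.
    by exists (a *: u' + v'); rewrite // smulDl smulZl.
  + move=> k z [x' _ <-]; exists (scomp R (k (+) j) x') => //.
    by rewrite (scomp_mulr _ _ xj).
  + by move=> r z [x' _ <-]; exists (r ** x'); rewrite ?smulA.
- by move=> z [r _ <-]; rewrite -xe; apply/LL/LL.
- apply: NNPP => nex; case/eqP: x0; apply: right_annihilator0 => r.
  by apply: NNPP => rx; apply: nex; exists (r ** x) => //; exists r.
- by move=> r _ rx; exists r.
Qed.

End InvolutionSimple.

(** * Representation on a minimal left ideal *)

Section Coordinates.
Variables (F : fieldType) (V : vectType F).

Lemma scalar_form_sum (l : V -> F) N (f : 'I_N -> V) : scalar l ->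
  l (\sum_i f i) = \sum_i l (f i).
Proof.
move=> lin_l; have [g gE] := linear_map_of (lin_l : linear (l : V -> F^o)).
by rewrite -gE linear_sum; apply: eq_bigr => i _; rewrite gE.
Qed.

Lemma scalar_formZ (l : V -> F) a x : scalar l -> l (a *: x) = a * l x.
Proof.
move=> lin_l; have [g gE] := linear_map_of (lin_l : linear (l : V -> F^o)).
by rewrite -!gE linearZ.
Qed.

Lemma scalar_form0 (l : V -> F) : scalar l -> l 0 = 0.
Proof. by move=> ll; rewrite -(scale0r 0) scalar_formZ // mul0r. Qed.

Lemma family_coord (U : {vspace V}) N (v : 'I_N -> V) :
  (forall i, v i \in U) ->
  (forall x, x \in U -> exists c : 'I_N -> F, x = \sum_i c i *: v i) ->
  (forall c : 'I_N -> F, \sum_i c i *: v i = 0 -> forall i, c i = 0) ->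
  exists c : 'I_N -> V -> F,
    [/\ forall i, scalar (c i),
        forall x, x \in U -> x = \sum_i c i x *: v i
      & forall i j, c i (v j) = (i == j)%:R].
Proof.
move=> vU vspan vfree; have Xb := basis_of_family vU vspan vfree.
have e (i : 'I_N) : [tuple v i | i < N]`_i = v i by rewrite -tnth_nth tnth_mktuple.
exists (fun i => coord [tuple v i | i < N] i); split.
- by move=> i a x y; rewrite linearP.
- move=> x xU; rewrite {1}(coord_basis Xb xU).
  by apply: eq_bigr => i _; rewrite e.
- by move=> i j; rewrite -e coord_free ?(basis_free Xb) // eq_sym.
Qed.

(** Reads the scalar off a vector known to be a multiple of e; corner elements become elements of F
    in this way. *)
Lemma dual_functional (e : V) : e != 0 -> exists2 l : V -> F, scalar l & l e = 1.
Proof.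
move=> e0; exists (coord [tuple e] ord0) => [a x y|]; first by rewrite linearP.
have -> : e = [tuple e]`_(ord0 : 'I_1) by [].
by rewrite coord_free // seq1_free.
Qed.

Lemma vbasis_family (U : {vspace V}) : exists v : 'I_(\dim U) -> V,
  [/\ forall i, v i \in U,
      forall x, x \in U -> exists c : 'I_(\dim U) -> F, x = \sum_i c i *: v i
    & forall c : 'I_(\dim U) -> F, \sum_i c i *: v i = 0 -> forall i, c i = 0].
Proof.
exists (fun i => (vbasis U)`_i); split.
- by move=> i; apply/vbasis_mem/mem_nth; rewrite size_tuple.
- by move=> x xU; exists (fun i => coord (vbasis U) i x); apply: coord_vbasis.
- by apply/freeP; apply: basis_free (vbasisP U).
Qed.

Lemma linear_onto (W : vectType F) (f : {linear V -> W}) (I : finType)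
    (w : I -> W) :
  (forall y, exists c : I -> F, y = \sum_i c i *: w i) ->
  (forall i, exists x, f x = w i) -> forall y, exists x, f x = y.
Proof.
move=> wspan fw y; have [c ->] := wspan y.
have : \sum_i c i *: w i \in limg (linfun f).
  apply: memv_suml => i _; apply: memvZ; have [x <-] := fw i.
  by rewrite -[f x]lfunE memv_img ?memvf.
by case/memv_imgP => x _ ->; exists x; rewrite lfunE.
Qed.

End Coordinates.

Section MatrixGrading.
Variables (F : fieldType) (n m : nat).

(** An index i carries the parity [n <= i], and only the relative parity of row and column matters;
    the first block may therefore belong to odd basis vectors as well as to even ones. *)
Lemma sgrade_Mat k (M : Mat F n m) :
  (forall i j : 'I_(n + m), k != ((n <= i) (+) (n <= j))%N ->
     (M : 'M_(n + m)) i j = 0) <-> M \in sgrade (Mat F n m) k.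
Proof.
have gl (i : 'I_n) : (n <= lshift m i)%N = false by rewrite leqNgt /= ltn_ord.
have gr (i : 'I_m) : (n <= rshift n i)%N = true by rewrite leq_addr.
rewrite [_ \in _]mem_Mat_grade; split.
  by case: k => h; apply/andP; split; apply/eqP/matrixP => i j;
    rewrite !mxE h // ?gl ?gr.
by case: k => /andP[/eqP/matrixP h1 /eqP/matrixP h2] i j;
  rewrite -(splitK i) -(splitK j); case: (split i) => i'; case: (split j) => j';
  rewrite /unsplit ?gl ?gr // => _;
  try (by have := h1 i' j'; rewrite !mxE); by have := h2 i' j'; rewrite !mxE.
Qed.

End MatrixGrading.

(** * The corner of a primitive idempotent and the two representations *)

Section Corner.
Variables (F : closedFieldType) (A : superalgebra F) (e : A).
Hypothesis primE : primitive e.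
Let e_even : e \in sgrade A false. Proof. by case: primE. Qed.
Let ee : e ** e = e. Proof. by case: primE. Qed.
Let e0 : e != 0. Proof. by case: primE. Qed.

(** Right multiplication by d preserves the even part of Ae and has an eigenvector there, x d = a x;
    multiplying by r with r x = e gives d = e d = a e. *)
Lemma corner_even d : d \in sgrade A false -> e ** d = d -> d ** e = d ->
  exists a, d = a *: e.
Proof.
move=> d0 ed de.
have [|U UP] := @linpred_vspace _ A (fun x => x \in sgrade A false /\ x ** e = x).
  split=> [|a x y [x0 xe] [y0 ye]]; first by rewrite mem0v smul0l.
  by rewrite memvD ?memvZ // smulDl smulZl xe ye.
have [|||x [xU x0] [a xa]] := @eigenvector_on _ _ U (fun x => x ** d).
- exact: smul_linearl.
- apply/eqP => U0; case/eqP: e0; apply/eqP; rewrite -memv0 -U0; exact/UP.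
- move=> x /UP[x0 xe]; apply/UP; split; last by rewrite -smulA de.
  by have := sgrade_mul x0 d0.
have [xg xe] := proj1 (UP x) xU.
have [r [_ _ rx]] := primitiveP primE xg xe x0.
by exists a; rewrite -ed -rx -smulA xa smulZr.
Qed.

(** The square of a nonzero odd d is a e with a nonzero, and t is d divided by a square root of
    a. *)
Lemma corner_odd : (forall d, d \in sgrade A true -> e ** d = d -> d ** e = d ->
    d = 0) \/
  exists t, [/\ t \in sgrade A true, e ** t = t, t ** e = t & t ** t = e].
Proof.
case: (classic (exists d, [/\ d \in sgrade A true, e ** d = d, d ** e = d
    & d != 0])) => [[d [d1 ed de dn0]]|nex]; last first.
  by left=> d d1 ed de; apply/eqP/negP => /negP dn0; apply: nex; exists d.
right; have [|||a dd] := @corner_even (d ** d); first exact: (sgrade_mul d1 d1).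
- by rewrite smulA ed.
- by rewrite -smulA de.
have [r [_ _ rd]] := primitiveP primE d1 de dn0.
(* With r d = e, the value a = 0 would give d = e d = r (d d) = 0. *)
have a0 : a != 0.
  apply: contra dn0 => /eqP a0; rewrite -ed -rd -smulA dd a0 scale0r smul0r.
  exact: eqxx.
have [c c2] := closed_sqrt a.
have c0 : c != 0 by apply: contra a0 => /eqP h; rewrite -c2 h expr0n.
exists (c^-1 *: d); split.
- exact: memvZ.
- by rewrite smulZr ed.
- by rewrite smulZl de.
- by rewrite smulZl smulZr dd !scalerA -c2 expr2 -!mulrA mulKf // mulVf // scale1r.
Qed.

Lemma ideal_space : exists V : {vspace A}, forall x, x \in V <-> x ** e = x.
Proof.
apply: linpred_vspace; split=> [|a x y xe ye]; first by rewrite smul0l.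
by rewrite smulDl smulZl xe ye.
Qed.

Lemma scomp_ideal i x : x ** e = x -> scomp A i x ** e = scomp A i x.
Proof. by move=> xe; rewrite -{1}[i]addbF -scomp_mulr // xe. Qed.

Section MatrixCase.
Hypothesis corner1 : forall d, d \in sgrade A true -> e ** d = d -> d ** e = d ->
  d = 0.

Lemma corner_scalar d : e ** d = d -> d ** e = d -> exists a, d = a *: e.
Proof.
move=> ed de.
have e_scomp i : e ** scomp A i d = scomp A i d.
  by rewrite -{1}[i]addbF -scomp_mull // ed.
have [|||a ha] := @corner_even (scomp A false d); [exact: scomp_mem|exact: e_scomp
  |exact: scomp_ideal|].
exists a; rewrite -(scomp_add false d) ha [scomp A (~~ _) d]corner1 ?addr0 //.
- exact: scomp_mem.
- exact: scomp_ideal.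
Qed.

(** For a nonzero component x_i some r in eA of degree i has r x_i = e, and r sends the other
    component into the odd corner, which is zero; so r x = e. *)
Lemma corner_nondegenerate x : x ** e = x ->
  (forall f, e ** f = f -> f ** x = 0) -> x = 0.
Proof.
move=> xe h.
suff x0 i : scomp A i x = 0 by rewrite -(scomp_add false x) !x0 addr0.
apply/eqP/negP => /negP xi.
have [r [ri er rx]] := primitiveP primE (scomp_mem i x) (scomp_ideal i xe) xi.
case/eqP: e0; have := h _ er.
rewrite -(scomp_add i x) smulDr rx [r ** _]corner1 ?addr0 //.
- by have := sgrade_mul ri (scomp_mem (~~ i) x); rewrite addbN addbb.
- by rewrite smulA er.
- by rewrite -smulA scomp_ideal.
Qed.

Variables (n m : nat) (v : 'I_(n + m) -> A) (flip : bool).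
Hypothesis v_grade : forall i, v i \in sgrade A (flip (+) (n <= i)%N).
Hypothesis v_ideal : forall i, v i ** e = v i.
Hypothesis v_span : forall x, x ** e = x -> exists c, x = \sum_i c i *: v i.
Hypothesis v_free : forall c : 'I_(n + m) -> F, \sum_i c i *: v i = 0 ->
  forall i, c i = 0.

Lemma matrix_representation : exists rho : {linear A -> Mat F n m},
  [/\ forall x y, rho (x ** y) = rho x ** rho y,
      forall i x, x \in sgrade A i -> rho x \in sgrade (Mat F n m) i,
      forall y, exists x, rho x = y
    & forall a j, a ** v j = \sum_i (rho a : 'M_(n + m)) i j *: v i].
Proof.
have [V VP] := ideal_space.
have [|x /VP|//|c [c_lin cE c_v]] := @family_coord _ _ V _ v; first by move=> i; apply/VP.
  exact: v_span.
pose r a : Mat F n m := \matrix_(i, j) c i (a ** v j).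
have r_lin : linear r.
  move=> a x y; apply/matrixP => i j; rewrite !mxE smulDl smulZl.
  exact: c_lin.
have [rho rhoE] := linear_map_of r_lin.
have act a j : a ** v j = \sum_i (rho a : 'M_(n + m)) i j *: v i.
  rewrite {1}(cE (a ** v j)); last by apply/VP; rewrite -smulA v_ideal.
  by apply: eq_bigr => i _; rewrite rhoE mxE.
exists rho; split=> //.
- move=> x y; apply/matrixP => i j; rewrite !rhoE !mxE -smulA (act y j).
  rewrite smul_sumr scalar_form_sum //; apply: eq_bigr => k _.
  by rewrite smulZr scalar_formZ // !mxE rhoE mulrC mxE.
- move=> k x xk; apply/sgrade_Mat => i j ne.
  have: scomp A (~~ (k (+) (flip (+) (n <= j)%N))) (x ** v j) = 0.
    exact: scomp_other (sgrade_mul xk (v_grade j)).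
  rewrite act linear_sum /=.
  (* [d] retains the entries of column j whose row lies in the block of i. The combination of basis
     vectors with these coefficients is the component of x v_j in the wrong degree, so it vanishes,
     and freeness kills the entry. *)
  pose d (i' : 'I_(n + m)) := if (n <= i')%N == (n <= i)%N then (rho x : 'M_(n + m)) i' j else 0.
  move=> h; suff : d i = 0 by rewrite /d eqxx.
  apply: (v_free (c := d)); rewrite -[RHS]h; apply: eq_bigr => i' _.
  rewrite linearZ /= /d; have vi' := v_grade i'.
  have [ei|ni] := eqVneq (n <= i')%N (n <= i)%N.
    congr (_ *: _); rewrite scomp_id //; move: vi' ne; rewrite ei.
    by case: (n <= i)%N (n <= j)%N k flip {h xk} => [] [] [] [].
  rewrite scale0r; have -> : ~~ (k (+) (flip (+) (n <= j)%N)) = ~~ (flip (+) (n <= i')%N).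
    by move: ne ni; case: (n <= i)%N (n <= j)%N (n <= i')%N k flip {h xk d vi'} => [] [] [] [] [].
  by rewrite scomp_other ?scaler0.
have [l l_lin le] := dual_functional e0.
have [W WP] : exists W : {vspace A}, forall x, x \in W <-> e ** x = x.
  apply: linpred_vspace; split=> [|a x y xe ye]; first by rewrite smul0r.
  by rewrite smulDr smulZr xe ye.
have lE f k : e ** f = f -> f ** v k = l (f ** v k) *: e.
  move=> ef; have [||a ->] := @corner_scalar (f ** v k).
  - by rewrite smulA ef.
  - by rewrite -smulA v_ideal.
  - by rewrite scalar_formZ // le mulr1.
have dual j : exists2 f, e ** f = f & forall k, f ** v k = (k == j)%:R *: e.
  have [|c' h|f /WP ef fE] := @dual_family _ _ W _ (fun k f => l (f ** v k)) _ _ j.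
  - by move=> k a x y; rewrite smulDl smulZl; apply: l_lin.
  - apply: v_free; apply: corner_nondegenerate.
      rewrite smul_suml; apply: eq_bigr => k _; rewrite smulZl.
      by rewrite v_ideal.
    move=> f ef; rewrite smul_sumr.
    under eq_bigr do rewrite smulZr lE // scalerA.
    by rewrite -scaler_suml h ?scale0r //; apply/WP.
  - by exists f => // k; rewrite lE // fE.
apply: (@linear_onto _ _ _ _ _
  (fun p : 'I_(n + m) * 'I_(n + m) => delta_mx p.1 p.2)).
- move=> y; exists (fun p => (y : 'M_(n + m)) p.1 p.2).
  by rewrite -(pair_bigA _ (fun i j => (y : 'M_(n + m)) i j *: delta_mx i j)) /=
    -matrix_sum_delta.
(* As f is dual to v_j, the product v_i f sends v_k to v_i if k = j and to 0 otherwise: it acts as a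
   matrix unit. *)
case=> i j; have [f _ fE] := dual j; exists (v i ** f).
apply/matrixP => i' j'; rewrite rhoE !mxE -smulA fE smulZr v_ideal.
by rewrite scalar_formZ // c_v -natrM mulnb andbC.
Qed.

End MatrixCase.

Section QueerCase.
Variable t : A.
Hypotheses (t_odd : t \in sgrade A true) (te : t ** e = t).
Hypothesis tt : t ** t = e.

(** Right multiplication by t commutes with the left action and maps the even part of Ae bijectively
    onto the odd part. A basis v of the even part thus yields the basis v, v t of Ae, and the
    coordinates of the a v_j form two matrices that multiply as in Q(n). *)
Lemma queer_representation : exists n (rho : {linear A -> Queer F n}),
  [/\ forall x y, rho (x ** y) = rho x ** rho y,
      forall i x, x \in sgrade A i -> rho x \in sgrade (Queer F n) i,
      forall y, exists x, rho x = y
    & rho e <> 0].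
Proof.
have [V VP] : exists V : {vspace A},
    forall x, x \in V <-> x \in sgrade A false /\ x ** e = x.
  apply: linpred_vspace; split=> [|a x y [x0 xe] [y0 ye]].
    by rewrite mem0v smul0l.
  by rewrite memvD ?memvZ // smulDl smulZl xe ye.
have [v [vV vspan vfree]] := vbasis_family V.
move: (\dim V) v vV vspan vfree => n v vV vspan vfree.
have v0 i : v i \in sgrade A false by have /VP[] := vV i.
have ve i : v i ** e = v i by have /VP[] := vV i.
have [c [c_lin cE c_v]] := family_coord vV vspan vfree.
(* Coordinates along v_i and along v_i t; on Ae, right multiplication by t interchanges them. *)
pose c0 i x := c i (scomp A false x).
pose c1 i x := c i (scomp A true x ** t).
have c0_lin i : scalar (c0 i).
  by move=> a x y; rewrite /c0 linearP c_lin.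
have c1_lin i : scalar (c1 i).
  by move=> a x y; rewrite /c1 linearP smulDl smulZl c_lin.
have c0t i x : c0 i (x ** t) = c1 i x.
  by rewrite /c0 /c1 (scomp_mulr _ _ t_odd).
have c1t i x : x ** e = x -> c1 i (x ** t) = c0 i x.
  by move=> xe; rewrite /c0 /c1 (scomp_mulr _ _ t_odd) -smulA tt scomp_ideal.
have c01E x : x ** e = x ->
    x = \sum_i (c0 i x *: v i + c1 i x *: (v i ** t)).
  move=> xe; rewrite big_split /= -{1}(scomp_add false x); congr (_ + _).
    by apply: cE; apply/VP; rewrite scomp_mem scomp_ideal.
  have -> : scomp A true x = (scomp A true x ** t) ** t.
    by rewrite -smulA tt scomp_ideal.
  rewrite {1}(cE (scomp A true x ** t)).
    rewrite smul_suml; by apply: eq_bigr => i _; rewrite smulZl.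
  apply/VP; rewrite -smulA te; split=> //.
  by have := sgrade_mul (scomp_mem true x) t_odd.
pose r a : Queer F n :=
  (\matrix_(i, j) c0 i (a ** v j), \matrix_(i, j) c1 i (a ** v j)).
have r_lin : linear r.
  by move=> a x y; congr pair; apply/matrixP => i j; rewrite !mxE smulDl smulZl
    ?c0_lin ?c1_lin.
have [rho rhoE] := linear_map_of r_lin.
have yv y j : (y ** v j) ** e = y ** v j by rewrite -smulA ve.
exists n, rho; split.
- move=> x y; rewrite !rhoE; congr pair; apply/matrixP => i j; rewrite !mxE -smulA
    (c01E _ (yv y j)) smul_sumr scalar_form_sum // -big_split /=; apply: eq_bigr => k _.
    rewrite smulDr !smulZr smulA c0_lin scalar_formZ // c0t !mxE.
    by congr (_ + _); rewrite mulrC.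
  rewrite smulDr !smulZr smulA c1_lin scalar_formZ // c1t // !mxE addrC.
  by congr (_ + _); rewrite mulrC.
- move=> k x xk; rewrite [_ \in _]mem_Queer_grade rhoE.
  have h j : x ** v j \in sgrade A k by have := sgrade_mul xk (v0 j); rewrite addbF.
  case: k h {xk} => h; apply/eqP/matrixP => i j; rewrite !mxE.
    by rewrite /c0 (scomp_other (h j)) scalar_form0.
  by rewrite /c1 (scomp_other (h j)) smul0l scalar_form0.
- have [l l_lin le] := dual_functional e0.
  have [W WP] : exists W : {vspace A},
      forall x, x \in W <-> x \in sgrade A false /\ e ** x = x.
    apply: linpred_vspace; split=> [|a x y [x0 xe] [y0 ye]].
      by rewrite mem0v smul0r.
    by rewrite memvD ?memvZ // smulDr smulZr xe ye.
  have lE f k : f \in W -> f ** v k = l (f ** v k) *: e.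
    move=> /WP[f0 ef]; have [|||a ->] := @corner_even (f ** v k).
    - exact: (sgrade_mul f0 (v0 k)).
    - by rewrite smulA ef.
    - by rewrite -smulA ve.
    - by rewrite scalar_formZ // le mulr1.
  have dual j : exists f, forall k, f ** v k = (k == j)%:R *: e.
    have [|c' h|f fW fE] := @dual_family _ _ W _ (fun k f => l (f ** v k)) _ _ j.
    - by move=> k a x y; rewrite smulDl smulZl; apply: l_lin.
    - apply: vfree; apply/eqP/negP => /negP ne0.
      have [||s [s0 es sx]] := primitiveP (i := false) primE _ _ ne0.
      + by apply: memv_suml => k _; apply: memvZ.
      + by rewrite smul_suml; apply: eq_bigr => k _; rewrite smulZl ve.
      case/eqP: e0; rewrite -sx smul_sumr.
      have sW : s \in W by apply/WP.
      under eq_bigr do rewrite smulZr lE // scalerA.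
      by rewrite -scaler_suml h ?scale0r.
    - by exists f => k; rewrite lE // fE.
  have c0v i j : c0 i (v j) = (i == j)%:R by rewrite /c0 scomp_id.
  have c1v i j : c1 i (v j) = 0.
    by rewrite /c1 (scomp_other (v0 j)) smul0l scalar_form0.
  apply: (@linear_onto _ _ _ _ _ (fun p : bool * ('I_n * 'I_n) =>
    if p.1 then (0, delta_mx p.2.1 p.2.2) else (delta_mx p.2.1 p.2.2, 0))).
  + move=> [y z]; exists (fun p => if p.1 then z p.2.1 p.2.2 else y p.2.1 p.2.2).
    have [gl glE] : exists g : {linear 'M_n -> Queer F n}, g =1 (fun y => (y, 0)).
      by apply: linear_map_of => a p q; congr pair; rewrite /= ?scaler0 ?addr0.
    have [gr grE] : exists g : {linear 'M_n -> Queer F n}, g =1 (fun y => (0, y)).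
      by apply: linear_map_of => a p q; congr pair; rewrite /= ?scaler0 ?addr0.
    have -> : (y, z) = gr z + gl y :> Queer F n.
      by rewrite glE grE; congr pair; rewrite ?add0r ?addr0.
    rewrite -(pair_bigA _ (fun (b : bool) (q : 'I_n * 'I_n) =>
      (if b then z q.1 q.2 else y q.1 q.2) *:
      ((if b then (0, delta_mx q.1 q.2) else (delta_mx q.1 q.2, 0)) : Queer F n))) /=.
    rewrite big_bool /=.
    rewrite -(pair_bigA _ (fun i j => z i j *: ((0, delta_mx i j) : Queer F n))).
    rewrite -(pair_bigA _ (fun i j => y i j *: ((delta_mx i j, 0) : Queer F n))).
    rewrite {1}[z]matrix_sum_delta {1}[y]matrix_sum_delta !linear_sum /=.
    congr (_ + _); apply: eq_bigr => i _; rewrite linear_sum;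
      by apply: eq_bigr => j _; rewrite linearZ /= ?glE ?grE.
  case=> b [i j]; have [f fE] := dual j; rewrite /=.
  (* Since f v_k is e for k = j and 0 otherwise, v_i f acts as the even matrix unit, and v_i t f,
     which sends v_j to v_i t, as the odd one. *)
  exists ((if b then v i ** t else v i) ** f); rewrite rhoE.
  case: b; congr pair; apply/matrixP => i' j'; rewrite !mxE -smulA fE smulZr;
    rewrite -?[(v i ** t) ** e]smulA ?te ?ve ?[c0 _ _]scalar_formZ ?[c1 _ _]scalar_formZ //.
  + by rewrite c0t c1v mulr0.
  + by rewrite c1t // c0v -natrM mulnb andbC.
  + by rewrite c0v -natrM mulnb andbC.
  + by rewrite c1v mulr0.
(* If rho e were zero, e would kill every v_j; but e is a combination of them and e e = e. *)
move=> re0.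
have ev j : e ** v j = 0.
  rewrite (c01E _ (yv e j)) big1 // => i _; move: re0; rewrite rhoE => -[].
  by move=> /matrixP/(_ i j) + /matrixP/(_ i j); rewrite !mxE => -> ->;
    rewrite !scale0r addr0.
have [|a ea] := vspan e; first exact/VP.
case/eqP: e0; rewrite -ee {2}ea smul_sumr big1 // => i _.
by rewrite smulZr ev scaler0.
Qed.

End QueerCase.
End Corner.

(** * The exchange and queer cases *)

Lemma graded_map_scomp (F : fieldType) (A B : superalgebra F)
    (rho : {linear A -> B}) :
  (forall i x, x \in sgrade A i -> rho x \in sgrade B i) ->
  forall i x, rho (scomp A i x) = scomp B i (rho x).
Proof.
move=> grd i x; rewrite -{2}(scomp_add i x) !linearD /=.
rewrite (scomp_id (grd _ _ (scomp_mem i x))).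
have := scomp_other (grd _ _ (scomp_mem (~~ i) x)).
by rewrite negbK => ->; rewrite addr0.
Qed.

Section Exchange.
Variables (F : fieldType) (R : invsuperalgebra F).
Hypothesis simpleR : involution_simple R.
Notation star := (istar R).
Variables (T : superalgebra F) (rho : {linear R -> T}).
Hypothesis rhoM : forall x y, rho (x ** y) = rho x ** rho y.
Hypothesis rhoG : forall i x, x \in sgrade R i -> rho x \in sgrade T i.
Hypothesis rho_onto : forall y, exists x, rho x = y.

Lemma kernel_gideal : gideal (fun x => rho x = 0).
Proof.
split.
- split=> [|a x y x0 y0]; first exact: linear0.
  by rewrite linearP x0 y0 scaler0 addr0.
- by move=> i x x0; rewrite graded_map_scomp // x0 linear0.
- by move=> r x x0; rewrite rhoM x0 smul0r.
- by move=> r x x0; rewrite rhoM x0 smul0l.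
Qed.

(** With K = ker rho, R = K + star K, so every value of rho is attained on star K, where the second
    coordinate of phi vanishes, and every value of the second coordinate on K, where the first
    vanishes; this makes phi onto. *)
Lemma exchange_isomorphic : (exists x, rho x <> 0) ->
  (exists2 x, rho x = 0 & x <> 0) -> R ~=* exchange T.
Proof.
move=> [w w0] ker_nz.
have rho_star x y : rho (star (x ** y)) = sop_mul (rho (star x)) (rho (star y)).
  rewrite star_mul /sop_mul linear_sum; apply: eq_bigr => i _.
  rewrite linear_sum; apply: eq_bigr => j _.
  by rewrite linearZ /= rhoM !graded_map_scomp.
have [phi phiE] : exists phi : {linear R -> exchange T},
    phi =1 (fun x => (rho x, rho (star x))).
  apply: linear_map_of => a x y; congr pair; first exact: linearP.
  by rewrite starZD linearP.
have onto_star y : exists2 z, rho z = 0 & rho (star z) = y.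
  have [x <-] := rho_onto y.
  have [x1 [x2 [h1 h2 ->]]] := gideal_add_star simpleR kernel_gideal ker_nz x.
  by exists x2; rewrite // linearD h1 add0r.
exists phi; split.
- apply: linear_bijective.
    move=> x; rewrite phiE => -[h1 h2].
    apply: (gideal_cap_star simpleR kernel_gideal) h1 h2 => full.
    exact: w0 (full w).
  move=> [y z]; have [y' hy <-] := onto_star y; have [z' hz <-] := onto_star z.
  exists (star y' + z'); rewrite phiE starD starK !linearD hy hz /=.
  by rewrite addr0 add0r.
- by move=> x y; rewrite !phiE rhoM rho_star.
- by move=> i x xi; rewrite phiE [_ \in _]mem_dsum_grade /= !rhoG // star_grade.
- by move=> x; rewrite !phiE starK.
Qed.

End Exchange.

Lemma central_matrix_scalar (F : fieldType) n (M : 'M[F]_n) :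
  (forall B, M *m B = B *m M) -> exists a, M = a%:M.
Proof.
case: n M => [|n] M cM; first by exists 0; apply/matrixP => -[].
exists (M 0 0); apply/matrixP => i j; rewrite !mxE.
(* The (i, 0) entry of M E, with E the matrix unit (j, 0), is M i j; that of E M is M 0 0 if i = j
   and 0 otherwise. *)
have := congr1 (fun B : 'M_(_, _) => B i 0) (cM (delta_mx j 0)).
rewrite !mxE (bigD1 j) //= big1 => [|k kj]; last first.
  by rewrite mxE (negPf kj) mulr0.
rewrite mxE !eqxx mulr1 addr0 => ->.
rewrite (bigD1 0) //= big1 => [|k k0]; last by rewrite mxE (negPf k0) andbF mul0r.
by rewrite mxE eqxx andbT addr0 mulr_natl.
Qed.

Section QueerStar.
Variables (F : fieldType) (charF : 2%N \notin [pchar F]).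
Variables (R : invsuperalgebra F) (n : nat) (rho : {linear R -> Queer F n}).
Notation star := (istar R).
Hypothesis rhoM : forall x y, rho (x ** y) = rho x ** rho y.
Hypothesis rhoG : forall i x, x \in sgrade R i -> rho x \in sgrade (Queer F n) i.
Hypothesis rho_onto : forall y, exists x, rho x = y.
Hypothesis rho_inj : forall x, rho x = 0 -> x = 0.

(* The odd central square root t of 1 must satisfy t^* = c t with c^2 = 1,
   whence 1 = 1^* = (t t)^* = - t^* t^* = -1. *)
Lemma queer_superinvolution_trivial : forall x : R, x = 0.
Proof.
have inj x y : rho x = rho y -> x = y.
  by move=> h; apply/eqP; rewrite -subr_eq0; apply/eqP/rho_inj;
    rewrite linearB h subrr.
have [t tE] := rho_onto ((0, 1%:M) : Queer F n).
have [o oE] := rho_onto ((1%:M, 0) : Queer F n).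
have qE (x y : Queer F n) :
  x ** y = (x.1 *m y.1 + x.2 *m y.2, x.1 *m y.2 + x.2 *m y.1) by [].
have tt : t ** t = o.
  by apply: inj; rewrite rhoM oE tE qE /= !mul0mx !mul1mx !add0r.
have tC x : t ** x = x ** t.
  apply: inj; rewrite !rhoM tE !qE /= !mul0mx !mulmx0 !mul1mx !mulmx1.
  by rewrite !add0r addr0.
have oL x : o ** x = x.
  apply: inj; rewrite !rhoM oE !qE /= !mul0mx !mul1mx !addr0.
  by case: (rho x).
have oR x : x ** o = x.
  apply: inj; rewrite !rhoM oE !qE /= !mulmx0 !mulmx1 addr0 add0r.
  by case: (rho x).
have todd : t \in sgrade R true.
  rewrite sgrade_scomp; apply/eqP/rho_inj; rewrite graded_map_scomp // tE.
  apply: (@scomp_other _ (Queer F n) true).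
  by rewrite [_ \in _]mem_Queer_grade.
have oeven : o \in sgrade R false by rewrite -tt; apply: (sgrade_mul todd todd).
have sodd : star t \in sgrade R true by apply: star_grade.
have sC x : star t ** x = x ** star t.
  elim/homog_ind: x => [x y hx hy|i x xi]; first by rewrite smulDl smulDr hx hy.
  have sx := star_grade xi.
  have := congr1 star (tC (star x)).
  rewrite (star_mul_homog todd sx) (star_mul_homog sx todd) starK.
  by rewrite andbC => /(scalerI _) ->; rewrite ?signr_eq0.
(* This product is even and central, so its even matrix is scalar; multiplying by t, whose square is
   the unit, turns this into star t = c t. *)
pose z := star t ** t.
have zeven : z \in sgrade R false by have := sgrade_mul sodd todd.
have [c zE] : exists c, z = c *: o.
  have z2 : (rho z).2 = 0.
    by have := rhoG zeven; rewrite [_ \in _]mem_Queer_grade => /eqP.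
  have [|c cE] := @central_matrix_scalar _ _ (rho z).1.
    move=> B; have [x xE] := rho_onto ((B, 0) : Queer F n).
    have zx : z ** x = x ** z by rewrite /z -smulA tC smulA sC smulA.
    have := congr1 (fun x => (rho x).1) zx.
    by rewrite /= rhoM [in RHS]rhoM xE !qE /= z2 !mul0mx !addr0.
  exists c; apply: inj; rewrite linearZ /= oE [rho z]surjective_pairing cE z2.
  by congr pair; rewrite /= ?scaler0 // scale_scalar_mx mulr1.
have st : star t = c *: t.
  by rewrite -[LHS]oR -tt smulA -/z zE smulZl oL.
have so : star o = o.
  have := star_mul_homog oeven (star_grade oeven).
  by rewrite oL starK scale1r oL => <-.
have t2 : (c * c) *: t = t.
  by rewrite -{2}(starK t) st starZ st scalerA.
have o2 : o = - o.
  rewrite -{1}so -{1}tt (star_mul_homog todd todd) st smulZl smulZr scalerA.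
  by rewrite -smulZl t2 tt expr1 scaleN1r.
have o0 : o = 0.
  apply/eqP; have : 2%:R *: o == 0 by rewrite scaler_nat mulr2n {1}o2 addNr.
  by rewrite scaler_eq0 (negPf (char2_natr_neq0 charF)).
by move=> x; rewrite -[x]oL o0 smul0l.
Qed.

End QueerStar.

(** * The form whose adjoint is the superinvolution *)

Section AdjointForm.
Variables (F : closedFieldType) (R : invsuperalgebra F) (e : R).
Notation star := (istar R).
Hypothesis primE : primitive e.
Hypothesis corner1 : forall d, d \in sgrade R true -> e ** d = d -> d ** e = d ->
  d = 0.
Hypothesis faithful : forall a, (forall x, x ** e = x -> a ** x = 0) -> a = 0.
Let e_even : e \in sgrade R false. Proof. by case: primE. Qed.
Let ee : e ** e = e. Proof. by case: primE. Qed.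
Let e0 : e != 0. Proof. by case: primE. Qed.

Lemma star_mul_evenr x y : y \in sgrade R false ->
  star (x ** y) = star y ** star x.
Proof.
move=> y0; elim/homog_ind: x => [x x' hx hx'|i x xi].
  by rewrite smulDl !starD hx hx' smulDr.
by rewrite (star_mul_homog xi y0) andbF scale1r.
Qed.

Lemma star_mul_evenl x y : x \in sgrade R false ->
  star (x ** y) = star y ** star x.
Proof.
move=> x0; elim/homog_ind: y => [y y' hy hy'|i y yi].
  by rewrite smulDr !starD hy hy' smulDl.
by rewrite (star_mul_homog x0 yi) scale1r.
Qed.

Let e' := star e.
Let e'_even : e' \in sgrade R false. Proof. exact: star_grade. Qed.
Let e'e' : e' ** e' = e'. Proof. by rewrite -star_mul_evenr // ee. Qed.

(** The space is nonzero because star e is nonzero and cannot annihilate Re. If r u = e, any z in it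
    equals w u with w = z r e'; this w lies in e' R e', which is the star of the corner eRe and
    hence the line through e'. *)
Lemma mixed_corner : exists d u, [/\ u \in sgrade R d, u != 0, e' ** u = u, u ** e = u
  & forall z, e' ** z = z -> z ** e = z -> exists a, z = a *: u].
Proof.
have [y [ye y0]] : exists y, y ** e = y /\ e' ** y <> 0.
  apply: NNPP => nex; case/eqP: e0; apply/star_eq0/faithful => x xe.
  by apply: NNPP => h; apply: nex; exists x.
have [d d0] : exists d, scomp R d (e' ** y) != 0.
  apply: NNPP => nex; apply: y0.
  have h k : scomp R k (e' ** y) = 0.
    by apply/eqP/negP => /negP h; apply: nex; exists k.
  by rewrite -(scomp_add false (e' ** y)) !h addr0.
pose u := scomp R d (e' ** y).
have ud : u \in sgrade R d by apply: scomp_mem.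
have e'u : e' ** u = u.
  by rewrite /u -{1}[d]addbF -(scomp_mull _ _ e'_even) smulA e'e'.
have ue : u ** e = u.
  by rewrite /u -{1}[d]addbF -(scomp_mulr _ _ e_even) -smulA ye.
exists d, u; split=> // z e'z ze.
have [r [_ er ru]] := primitiveP primE ud ue d0.
pose w := z ** r ** e'.
have zE : z = w ** u by rewrite /w -smulA e'u -smulA ru ze.
have [||a wE] := @corner_scalar _ _ _ primE corner1 (star w).
- by rewrite /w -[e in LHS]starK -star_mul_evenr // -smulA e'e'.
- by rewrite -[e in LHS]starK -star_mul_evenl // /w !smulA e'z.
exists a; rewrite zE -[w]starK wE starZ smulZl.
by rewrite [star e ** u]e'u.
Qed.

Definition homog_ideal i x := x \in sgrade R i /\ x ** e = x.

(* With u spanning e^* R e, set x^* y = b(x, y) u up to a sign depending on |y|.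
   If u^* = - u the sign makes b supersymmetric for the opposite parity of Re,
   which is what [flip] records. *)
Lemma adjoint_form : exists (d flip : bool) (b : R -> R -> F),
  [/\ (forall y, scalar (b^~ y)) /\ (forall x, scalar (b x)),
      forall i j x y, homog_ideal i x -> homog_ideal j y -> i (+) j != d ->
        b x y = 0,
      forall i j x y, homog_ideal i x -> homog_ideal j y ->
        b y x = (-1) ^+ ((flip (+) i) && (flip (+) j)) * b x y,
      forall x, x ** e = x -> (forall y, y ** e = y -> b x y = 0) -> x = 0
    & forall k i j a x y, a \in sgrade R k ->
        homog_ideal i x -> homog_ideal j y ->
        b x (star a ** y) = (-1) ^+ (k && (flip (+) i)) * b (a ** x) y].
Proof.
have [d [u [ud u0 e'u ue u1]]] := mixed_corner.
have [eps uE] : exists eps, star u = eps *: u.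
  apply: u1; first by rewrite -star_mul_evenr // ue.
  by rewrite -[e in LHS]starK -star_mul_evenl // [star e ** u]e'u.
have uI a b : a *: u = b *: u -> a = b.
  move=> h; apply/eqP; rewrite -subr_eq0.
  have /eqP : (a - b) *: u = 0 by rewrite scalerBl h subrr.
  by rewrite scaler_eq0 (negPf u0) orbF.
have [flip epsE] : exists flip : bool, eps = (-1) ^+ flip.
  have : eps ^+ 2 = 1.
    by apply: uI; rewrite expr2 -scalerA -uE -starZ -uE starK scale1r.
  by move/eqP; rewrite sqrf_eq1 => /orP[] /eqP ->; [exists false|exists true].
have [l l_lin lu] := dual_functional u0.
(* This sign absorbs star u = eps u: applying the superinvolution to the product of star x and y
   produces the total sign (-1)^(i j) eps s_i s_j, which equals (-1)^((flip + i)(flip + j)). *)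
pose s j : F := (-1) ^+ (flip && ~~ j).
pose sg y := s true *: scomp R true y + s false *: scomp R false y.
have sg_lin : linear sg.
  move=> a x y; have h k : scomp R k (a *: x + y) = a *: scomp R k x + scomp R k y.
    by rewrite linearP.
  rewrite /sg !h !scalerDr !scalerA addrACA.
  by rewrite ![_ * a]mulrC.
have sgE j y : y \in sgrade R j -> sg y = s j *: y.
  move=> yj; rewrite /sg; have := scomp_other yj; have := scomp_id yj.
  by case: j yj => _ /= -> ->; rewrite scaler0 ?addr0 ?add0r.
have sg_ideal y : y ** e = y -> sg y ** e = sg y.
  by move=> ye; rewrite /sg smulDl !smulZl !(scomp_ideal primE _ ye).
pose b x y := l (star x ** sg y).
have bE x y : x ** e = x -> y ** e = y -> star x ** sg y = b x y *: u.
  move=> xe ye; have [||a aE] := u1 (star x ** sg y).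
  - by rewrite smulA -star_mul_evenr // xe.
  - by rewrite -smulA sg_ideal.
  by rewrite /b aE scalar_formZ // lu mulr1.
have bEh i j x y : homog_ideal i x -> homog_ideal j y ->
    star x ** y = (s j * b x y) *: u.
  move=> [xi xe] [yj ye]; rewrite -scalerA -bE // (sgE _ _ yj) smulZr scalerA.
  by rewrite /s -signr_addb addbb scale1r.
exists d, flip, b; split.
- split=> [y a x x'|x a y y']; rewrite /b.
    by rewrite starZD smulDl smulZl l_lin.
  by rewrite sg_lin smulDr smulZr l_lin.
- move=> i j x y [xi xe] [yj ye] ne; apply: uI; rewrite scale0r -bE //.
  have h1 : star x ** sg y \in sgrade R (i (+) j).
    by rewrite (sgE _ _ yj) smulZr memvZ // sgrade_mul // star_grade.
  have h2 : star x ** sg y \in sgrade R d by rewrite bE // memvZ.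
  rewrite -(scomp_id h1); have -> : i (+) j = ~~ d.
    by move: ne; case: i j d {xi yj h1 h2 ud} => [] [] [].
  exact: scomp_other.
- move=> i j x y hx hy; have := congr1 star (bEh _ _ _ _ hx hy).
  rewrite starZ uE (star_mul_homog (star_grade (proj1 hx)) (proj1 hy)) starK.
  rewrite (bEh _ _ _ _ hy hx) !scalerA => /uI; rewrite epsE /s.
  set p := b y x; set q := b x y.
  by case: (i) (j) (flip) => [] [] []; rewrite /= ?expr0 ?expr1
    ?(mulN1r, mulrN1, mul1r, mulr1, opprK) => h;
    first [by rewrite -h ?opprK | by apply: oppr_inj; rewrite -h ?opprK].
- move=> x xe h; apply/star_eq0/faithful => y ye.
  have hk k : star x ** scomp R k y = 0.
    have yk : homog_ideal k (scomp R k y).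
      by split; [exact: scomp_mem|exact: scomp_ideal].
    have := bE _ _ xe (proj2 yk); rewrite h ?(proj2 yk) // scale0r.
    rewrite (sgE _ _ (proj1 yk)) smulZr => /eqP.
    by rewrite scaler_eq0 signr_eq0 => /eqP.
  by rewrite -(scomp_add false y) smulDr !hk addr0.
(* Here s_(k + j) s_j = (-1)^(k flip), which turns the sign (-1)^(k i) of the superinvolution into
   (-1)^(k (flip + i)). *)
move=> k i j a x y ak [xi xe] [yj ye]; apply: uI.
have ax : (a ** x) ** e = a ** x by rewrite -smulA xe.
have ay : (star a ** y) ** e = star a ** y by rewrite -smulA ye.
have ayk : star a ** y \in sgrade R (k (+) j).
  exact: (sgrade_mul (star_grade ak) yj).
rewrite -scalerA -!bE // (sgE _ _ yj) (sgE _ _ ayk).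
rewrite (star_mul_homog ak xi) smulZl !smulZr !scalerA smulA /s.
by congr (_ *: _); case: (k) (i) (j) (flip) => [] [] [] [];
  rewrite /= ?expr0 ?expr1 ?(mulN1r, mulrN1, mul1r, mulr1, opprK).
Qed.

End AdjointForm.

(** * Canonical matrices of the adjoint form *)

Lemma osp_form_unit (F : fieldType) r s : osp_form F r s \in unitmx.
Proof.
have h : block_mx 1%:M 0 0 (- symp_mx F s) *m osp_form F r s = 1%:M.
  rewrite mulmx_block !(mul0mx, mulmx0, add0r, addr0, mul1mx).
  by rewrite mulNmx symp_mx_sqr opprK -scalar_mx_block.
by have [] := mulmx1_unit h.
Qed.

(** Gram matrix of an odd form in a basis made of two isotropic halves dual to each other. *)
Definition trp_form (F : fieldType) r : 'M[F]_(r + r) :=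
  block_mx 0 1%:M 1%:M 0.

Lemma trp_form_sqr (F : fieldType) r : trp_form F r *m trp_form F r = 1%:M.
Proof.
rewrite mulmx_block !(mul0mx, mulmx0, add0r, addr0, mul1mx).
by rewrite -scalar_mx_block.
Qed.

Section SignedColumns.
Variables (F : fieldType) (n m : nat).

(** Column j receives the sign that the adjoint identity of b attaches to the j-th basis vector,
    whose parity relative to [flip] is [n <= j]. *)
Definition sign_columns (k : bool) (M : 'M[F]_(n + m)) : 'M[F]_(n + m) :=
  \matrix_(i, j) ((-1) ^+ (k && (n <= j)%N) * M i j).

(** For odd M only the upper right block is left in the columns that change sign; for even M no sign
    occurs and that block is zero. *)
Lemma sign_columns_homog k (M : Mat F n m) : M \in sgrade (Mat F n m) k ->
  sign_columns k M =
  block_mx (ulsubmx M) (- ursubmx M) (dlsubmx M) (drsubmx M).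
Proof.
have gl (i : 'I_n) : (n <= lshift m i)%N = false by rewrite leqNgt /= ltn_ord.
have gr (i : 'I_m) : (n <= rshift n i)%N = true by rewrite leq_addr.
rewrite [_ \in _]mem_Mat_grade => h; rewrite -[LHS]submxK; congr block_mx;
  apply/matrixP => i j; rewrite !mxE ?gl ?gr ?andbF ?andbT ?mul1r //.
  case: k h => /andP[/eqP h1 /eqP h2]; first by rewrite mulN1r.
  by have /matrixP/(_ i j) := h1; rewrite !mxE => ->; rewrite mulr0 oppr0.
case: k h => /andP[/eqP h1 /eqP h2]; last by rewrite mul1r.
by have /matrixP/(_ i j) := h2; rewrite !mxE => ->; rewrite mulr0.
Qed.

Lemma osp_star_form s (M : Mat F n (s + s)) : osp_form F n s *m osp_star M =
  (block_mx (ulsubmx M) (- ursubmx M) (dlsubmx M) (drsubmx M))^T *m osp_form F n s.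
Proof. by rewrite /osp_star !mulmxA mulmxV ?osp_form_unit // mul1mx. Qed.

Lemma trp_star_form (M : Mat F n n) : trp_form F n *m trp_star M =
  (block_mx (ulsubmx M) (- ursubmx M) (dlsubmx M) (drsubmx M))^T *m trp_form F n.
Proof.
have -> : (block_mx (ulsubmx M) (- ursubmx M) (dlsubmx M) (drsubmx M))^T =
    block_mx (ulsubmx M)^T (dlsubmx M)^T (- (ursubmx M)^T) (drsubmx M)^T.
  by rewrite tr_block_mx linearN.
rewrite /trp_star /trp_form !mulmx_block.
by rewrite !(mul0mx, mulmx0, add0r, addr0, mul1mx, mulmx1).
Qed.

End SignedColumns.

(** * From Gram matrices to the orthosymplectic and transpose superinvolutions *)

Section FormToMatrix.
Variables (F : closedFieldType) (charF : 2%N \notin [pchar F]).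
Variables (R : invsuperalgebra F) (e : R).
Notation star := (istar R).
Hypothesis primE : primitive e.
Hypothesis corner1 : forall d, d \in sgrade R true -> e ** d = d -> d ** e = d ->
  d = 0.
Hypothesis faithful : forall a, (forall x, x ** e = x -> a ** x = 0) -> a = 0.
Variables (d flip : bool) (b : R -> R -> F).
Hypothesis b_linl : forall y, scalar (b^~ y).
Hypothesis b_linr : forall x, scalar (b x).
Hypothesis b_grade : forall i j x y, homog_ideal e i x -> homog_ideal e j y ->
  i (+) j != d -> b x y = 0.
Hypothesis b_sym : forall i j x y, homog_ideal e i x -> homog_ideal e j y ->
  b y x = (-1) ^+ ((flip (+) i) && (flip (+) j)) * b x y.
Hypothesis b_nondeg : forall x, x ** e = x ->
  (forall y, y ** e = y -> b x y = 0) -> x = 0.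
Hypothesis b_adj : forall k i j a x y, a \in sgrade R k ->
  homog_ideal e i x -> homog_ideal e j y ->
  b x (star a ** y) = (-1) ^+ (k && (flip (+) i)) * b (a ** x) y.

(** In the basis v the adjoint identity says that G rho(star a) is the signed transpose of rho a
    times G, and G dag(rho a) is the same matrix by hypothesis; cancelling G identifies the two
    superinvolutions. What remains is to find a basis with a prescribed Gram matrix. *)
Lemma gram_isomorphic n m (dag : Mat F n m -> Mat F n m)
    (v : 'I_(n + m) -> R) (G : 'M[F]_(n + m)) :
  is_superinvolution dag -> G \in unitmx ->
  (forall M, G *m dag M =
    (block_mx (ulsubmx M) (- ursubmx M) (dlsubmx M) (drsubmx M))^T *m G) ->
  (forall i : 'I_(n + m), homog_ideal e (flip (+) (n <= i)%N) (v i)) ->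
  (forall x, x ** e = x -> exists c, x = \sum_i c i *: v i) ->
  (forall i j, b (v i) (v j) = G i j) ->
  exists rho : {linear R -> Mat F n m},
    [/\ bijective rho,
        forall x y, rho (x ** y) = rho x ** rho y,
        forall i x, x \in sgrade R i -> rho x \in sgrade (Mat F n m) i
      & forall x, rho (star x) = dag (rho x)].
Proof.
move=> dagP Gu dagG v_homog v_span vG.
have v_grade i : v i \in sgrade R (flip (+) (n <= i)%N) by case: (v_homog i).
have v_ideal i : v i ** e = v i by case: (v_homog i).
(* Pairing a linear relation with each v_j shows that the invertible G kills its column of
   coefficients. *)
have v_free (c : 'I_(n + m) -> F) : \sum_i c i *: v i = 0 -> forall i, c i = 0.
  move=> c0 i; have : G *m (\col_i c i) = 0.
    apply/matrixP => j k; rewrite !mxE.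
    have := congr1 (b (v j)) c0; rewrite (bform_sumr b_linr) (bform0r b_linr) => h.
    by rewrite -[RHS]h; apply: eq_bigr => l _; rewrite mxE (bformZr b_linr) vG mulrC.
  move/(congr1 (mulmx (invmx G))); rewrite mulmxA mulVmx // mul1mx mulmx0.
  by move/matrixP/(_ i 0); rewrite !mxE.
have [rho [rhoM rhoG rho_onto act]] :=
  matrix_representation primE corner1 v_grade v_ideal v_span v_free.
exists rho; split=> //.
  apply: linear_bijective => // x x0; apply: faithful => y ye.
  have [c ->] := v_span y ye; rewrite smul_sumr big1 // => j _.
  rewrite smulZr act big1 ?scaler0 // => i _.
  by rewrite x0 mxE scale0r.
case: dagP => dag_lin _ _ _.
elim/homog_ind => [x y hx hy|k a ak].
  rewrite starD !linearD /= hx hy.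
  by have := dag_lin 1 (rho x) (rho y); rewrite !scale1r.
suff h : G *m (rho (star a) : 'M_(n + m)) = G *m (dag (rho a) : 'M_(n + m)).
  have := congr1 (mulmx (invmx G)) h.
  by rewrite !mulmxA mulVmx // !mul1mx.
rewrite dagG -(sign_columns_homog (rhoG _ _ ak)).
apply/matrixP => i j; rewrite !mxE.
have := b_adj ak (v_homog i) (v_homog j).
rewrite !act (bform_sumr b_linr) (bform_suml b_linl) addbA addbb addFb.
under eq_bigr => l _ do rewrite (bformZr b_linr) vG mulrC.
move=> ->; rewrite mulr_sumr; apply: eq_bigr => l _.
by rewrite (bformZl b_linl) vG !mxE mulrA.
Qed.

Definition join_families n m (v : 'I_n -> R) (w : 'I_m -> R) (i : 'I_(n + m)) :=
  match split i with inl j => v j | inr j => w j end.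

Lemma join_familiesl n m (v : 'I_n -> R) (w : 'I_m -> R) i :
  join_families v w (lshift m i) = v i.
Proof. by rewrite /join_families (unsplitK (inl i)). Qed.

Lemma join_familiesr n m (v : 'I_n -> R) (w : 'I_m -> R) i :
  join_families v w (rshift n i) = w i.
Proof. by rewrite /join_families (unsplitK (inr i)). Qed.

Lemma join_homog n m (v : 'I_n -> R) (w : 'I_m -> R) :
  (forall i, homog_ideal e flip (v i)) ->
  (forall i, homog_ideal e (~~ flip) (w i)) ->
  forall i : 'I_(n + m),
    homog_ideal e (flip (+) (n <= i)%N) (join_families v w i).
Proof.
move=> hv hw i; rewrite -(splitK i); case: (split i) => j.
  by rewrite join_familiesl [(n <= _)%N]leqNgt /= ltn_ord addbF.
by rewrite join_familiesr /= leq_addr addbT.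
Qed.

Lemma scomp_homog i x : x ** e = x -> homog_ideal e i (scomp R i x).
Proof. by move=> xe; split; [exact: scomp_mem|exact: scomp_ideal]. Qed.

Lemma join_span n m (v : 'I_n -> R) (w : 'I_m -> R) :
  (forall x, homog_ideal e flip x -> exists c, x = \sum_i c i *: v i) ->
  (forall x, homog_ideal e (~~ flip) x -> exists c, x = \sum_i c i *: w i) ->
  forall x, x ** e = x -> exists c, x = \sum_i c i *: join_families v w i.
Proof.
move=> hv hw x xe; have [c1 e1] := hv _ (scomp_homog flip xe).
have [c2 e2] := hw _ (scomp_homog (~~ flip) xe).
exists (fun i => match split i with inl j => c1 j | inr j => c2 j end).
rewrite -{1}(scomp_add flip x) e1 e2 big_split_ord /=; congr (_ + _);
  apply: eq_bigr => i _.
  by rewrite join_familiesl (unsplitK (inl i)).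
by rewrite join_familiesr (unsplitK (inr i)).
Qed.

Lemma join_gram n m (v : 'I_n -> R) (w : 'I_m -> R) (X : 'M[F]_n)
    (Y : 'M[F]_(n, m)) (Z : 'M[F]_(m, n)) (T : 'M[F]_m) :
  (forall i j, b (v i) (v j) = X i j) -> (forall i j, b (v i) (w j) = Y i j) ->
  (forall i j, b (w i) (v j) = Z i j) -> (forall i j, b (w i) (w j) = T i j) ->
  forall i j, b (join_families v w i) (join_families v w j) =
    block_mx X Y Z T i j.
Proof.
move=> hX hY hZ hT i j; rewrite -(splitK i) -(splitK j).
case: (split i) => i'; case: (split j) => j'; rewrite /unsplit
  ?join_familiesl ?join_familiesr.
- by rewrite block_mxEul.
- by rewrite block_mxEur.
- by rewrite block_mxEdl.
- by rewrite block_mxEdr.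
Qed.

Lemma homog_ideal_space i : exists U : {vspace R},
  forall x, x \in U <-> homog_ideal e i x.
Proof.
apply: linpred_vspace; split=> [|a x y [x0 xe] [y0 ye]].
  by split; rewrite ?mem0v ?smul0l.
by split; rewrite ?memvD ?memvZ // smulDl smulZl xe ye.
Qed.

(** An even form makes the two parities orthogonal, so it is nondegenerate on each. It is symmetric
    on degree [flip] and skew on the other degree, which puts an orthonormal basis in the first
    block and a symplectic one in the second. *)
Lemma orthosymplectic_case : d = false -> exists r s, R ~=* Mat_osp F r s.
Proof.
move=> d0.
have nd i (U : {vspace R}) : (forall x, x \in U <-> homog_ideal e i x) ->
    nondegenerate_on b U.
  move=> UP x /UP xh h; apply: b_nondeg; first by case: xh.
  move=> y ye; rewrite -(scomp_add i y) (bformDr b_linr) h ?add0r; last first.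
    exact/UP/scomp_homog.
  by rewrite (b_grade xh (scomp_homog (~~ i) ye)) // d0 addbN addbb.
have [U UP] := homog_ideal_space flip.
have [U' U'P] := homog_ideal_space (~~ flip).
have [|r [v [vU vv vspan]]] := orthonormal_basis charF b_linl b_linr _ (nd _ _ UP).
  by move=> x y /UP xh /UP yh; rewrite (b_sym yh xh) addbb mul1r.
have [|s [p [q [pqU pq0 pq1 pqspan]]]] :=
    symplectic_basis charF b_linl b_linr _ (nd _ _ U'P).
  by move=> x y /U'P xh /U'P yh; rewrite (b_sym yh xh) addbN addbb mulN1r.
have vh i : homog_ideal e flip (v i) by apply/UP.
have ph i : homog_ideal e (~~ flip) (p i) by apply/U'P; case: (pqU i).
have qh i : homog_ideal e (~~ flip) (q i) by apply/U'P; case: (pqU i).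
have wh i : homog_ideal e (~~ flip) (join_families p q i).
  by rewrite -(splitK i); case: (split i) => j; rewrite ?join_familiesl ?join_familiesr.
have cross x y : homog_ideal e flip x -> homog_ideal e (~~ flip) y ->
    (b x y = 0) * (b y x = 0).
  by move=> xh yh; rewrite (b_grade xh yh) ?(b_grade yh xh) // d0;
    case: (flip).
exists r, s; apply: (@gram_isomorphic _ _ _
  (join_families v (join_families p q)) (osp_form F r s)).
- exact: osp_starP.
- exact: osp_form_unit.
- exact: osp_star_form.
- exact: join_homog.
- apply: join_span => x xh.
    by exists (fun i => b (v i) x); apply: vspan; apply/UP.
  exists (fun i => match split i with inl j => b x (q j) | inr j => - b x (p j) end).
  rewrite big_split_ord /= {1}(pqspan x); last exact/U'P.
  rewrite big_split /=; congr (_ + _); apply: eq_bigr => i _.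
    by rewrite join_familiesl (unsplitK (inl i)).
  by rewrite join_familiesr (unsplitK (inr i)) scaleNr.
- apply: join_gram => i j.
  + by rewrite vv mxE.
  + by rewrite mxE (cross _ _ (vh i) (wh j)).
  + by rewrite mxE (cross _ _ (vh j) (wh i)).
  apply: (@join_gram _ _ _ _ 0 1%:M (- 1%:M) 0) => k l; rewrite !mxE.
  + by case: (pq0 k l).
  + exact: pq1.
  + by rewrite (b_sym (ph l) (qh k)) addbN addbb mulN1r pq1 eq_sym.
  + by case: (pq0 k l).
Qed.

(** An odd form vanishes on each parity and pairs the two perfectly, so any basis of degree [flip]
    has a dual basis in the other degree, and both blocks have the same size. Between opposite
    parities the sign in [b_sym] is 1. *)
Lemma transpose_case : d = true -> exists r, R ~=* Mat_trp F r.
Proof.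
move=> d1.
have [U UP] := homog_ideal_space flip.
have [U' U'P] := homog_ideal_space (~~ flip).
have [v [vU vspan vfree]] := vbasis_family U.
move: (\dim U) v vU vspan vfree => r v vU vspan vfree.
have vh i : homog_ideal e flip (v i) by apply/UP.
have same i x y : homog_ideal e i x -> homog_ideal e i y -> b x y = 0.
  by move=> xh yh; rewrite (b_grade xh yh) // d1 addbb.
have dual j : exists2 f, f \in U' & forall k, b (v k) f = (k == j)%:R.
  apply: (@dual_family _ _ U' _ (fun k f => b (v k) f)) => [k|c h].
    exact: b_linr.
  have ch : homog_ideal e flip (\sum_k c k *: v k).
    by apply/UP; apply: memv_suml => k _; apply: memvZ.
  apply: vfree; apply: b_nondeg; first by case: ch.
  move=> y ye; rewrite -(scomp_add flip y) (bformDr b_linr).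
  rewrite (same _ _ _ ch (scomp_homog flip ye)) add0r (bform_suml b_linl).
  under eq_bigr do rewrite (bformZl b_linl).
  by apply: h; apply/U'P/scomp_homog.
have [w wU' vw] := fin_all_exists2 dual.
have wh i : homog_ideal e (~~ flip) (w i) by apply/U'P.
exists r; apply: (@gram_isomorphic _ _ _
  (join_families v w) (trp_form F r)).
- exact: trp_starP.
- by have [] := mulmx1_unit (trp_form_sqr F r).
- exact: trp_star_form.
- exact: join_homog.
- apply: join_span => x xh; first by apply: vspan; apply/UP.
  exists (fun i => b (v i) x); apply/eqP; rewrite -subr_eq0; apply/eqP.
  (* The dual family spans: the remainder z is orthogonal to every v_i by construction and to its
     own parity because b is odd, so nondegeneracy gives z = 0. *)
  set z := x - _; have zh : homog_ideal e (~~ flip) z.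
    apply/U'P; rewrite memvB //; first exact/U'P.
    by apply: memv_suml => i _; apply: memvZ.
  have vz i : b (v i) z = 0.
    rewrite /z -scaleN1r (bformDr b_linr) (bformZr b_linr) (bform_sumr b_linr).
    rewrite (bigD1 i) //= (bformZr b_linr) vw eqxx mulr1 big1 ?addr0.
      by rewrite mulN1r subrr.
    move=> k /negPf ki; rewrite (bformZr b_linr) vw eq_sym ki.
    by rewrite mulr0.
  apply: b_nondeg; first by case: zh.
  move=> y ye; rewrite -(scomp_add flip y) (bformDr b_linr).
  rewrite (same _ _ _ zh (scomp_homog (~~ flip) ye)) addr0.
  rewrite (b_sym (scomp_homog flip ye) zh).
  have [|c ->] := vspan (scomp R flip y); first exact/UP/scomp_homog.
  rewrite (bform_suml b_linl) big1 ?mulr0 // => k _.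
  by rewrite (bformZl b_linl) vz mulr0.
apply: join_gram => i j; rewrite ?mxE.
- exact: same.
- exact: vw.
- by rewrite (b_sym (vh j) (wh i)) addbb mul1r vw eq_sym.
- exact: same (wh i) (wh j).
Qed.

End FormToMatrix.

(** * Assembly of the cases *)

Theorem proposition1 (F : closedFieldType) (charF : 2%N \notin [pchar F])
    (R : invsuperalgebra F) (R_simple : involution_simple R) :
  ((exists r s : nat, R ~=* Mat_osp F r s) \/
   (exists r : nat, R ~=* Mat_trp F r)) \/
  (exists n m : nat, R ~=* exchange (Mat F n m)) \/
  (exists n : nat, R ~=* exchange (Queer F n)).
Proof.
have [e primE] := exists_primitive R_simple.
have [_ ee /eqP e0 _] := primE.
have [corner1|[t [t1 et te tt]]] := corner_odd primE; last first.
  have [n [rho [rhoM rhoG rho_onto rho_e]]] := queer_representation primE t1 te tt.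
  right; right; exists n; apply: (exchange_isomorphic R_simple rhoM rhoG rho_onto).
    by exists e.
  apply: NNPP => nex; apply: e0.
  apply: (queer_superinvolution_trivial charF rhoM rhoG rho_onto) => x x0.
  by apply: NNPP => xn0; apply: nex; exists x.
(* Faithfulness on Re amounts to injectivity of rho; it is decided before a basis is chosen because
   the faithful case needs a basis adapted to b. *)
case: (classic (forall a, (forall x, x ** e = x -> a ** x = 0) -> a = 0)).
  move=> faithful; left.
  have [d [flip [b [[bl br] bg bs bn ba]]]] := adjoint_form primE corner1 faithful.
  case: d bg => bg.
    by right; apply: (transpose_case primE corner1 faithful bl br bg bs bn ba).
  by left; apply: (orthosymplectic_case charF primE corner1 faithful bl br bg bs bn ba).
move=> unfaithful; right; left.
have [U0 U0P] := homog_ideal_space e false.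
have [U1 U1P] := homog_ideal_space e true.
have [v [vU vspan vfree]] := vbasis_family U0.
have [w [wU wspan wfree]] := vbasis_family U1.
move: (\dim U0) (\dim U1) v w vU vspan vfree wU wspan wfree.
move=> n m v w vU vspan vfree wU wspan wfree.
pose vw := join_families v w.
have vwh : forall i : 'I_(n + m), homog_ideal e (false (+) (n <= i)%N) (vw i).
  by apply: join_homog => i; [apply/U0P|apply/U1P].
have vwspan : forall x, x ** e = x -> exists c, x = \sum_i c i *: vw i.
  apply: (join_span (flip := false) primE) => x xh.
    by apply: vspan; apply/U0P.
  by apply: wspan; apply/U1P.
have vwfree (c : 'I_(n + m) -> F) : \sum_i c i *: vw i = 0 -> forall i, c i = 0.
  rewrite big_split_ord /=.
  under eq_bigr do rewrite /vw join_familiesl.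
  under [X in _ + X]eq_bigr do rewrite /vw join_familiesr.
  set x := \sum_i _; set y := \sum_i _ => xy0.
  have x0 : x \in sgrade R false.
    by apply: memv_suml => i _; apply: memvZ; have /U0P[] := vU i.
  have y1 : y \in sgrade R true.
    by apply: memv_suml => i _; apply: memvZ; have /U1P[] := wU i.
  have hx : x = 0.
    have := congr1 (scomp R false) xy0; rewrite linearD linear0 /=.
    by rewrite (scomp_id x0) (scomp_other y1) addr0.
  have hy : y = 0 by move: xy0; rewrite hx add0r.
  move=> i; rewrite -(splitK i); case: (split i) => j.
    by apply: (vfree (fun i => c (lshift m i))).
  by apply: (wfree (fun i => c (rshift n i))).
have [rho [rhoM rhoG rho_onto act]] := matrix_representation primE corner1
  (fun i => proj1 (vwh i)) (fun i => proj2 (vwh i)) vwspan vwfree.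
exists n, m; apply: (exchange_isomorphic R_simple rhoM rhoG rho_onto).
  exists e => re0; apply: e0.
  have [c ec] := vwspan e ee.
  rewrite -ee {2}ec smul_sumr big1 // => i _.
  rewrite smulZr act big1 ?scaler0 // => j _.
  by rewrite re0 mxE scale0r.
(* An element that kills Re has zero matrix, so a trivial kernel would make the action faithful. *)
apply: NNPP => nex; apply: unfaithful => a ax.
apply: NNPP => a0; apply: nex; exists a => //.
have z j : \sum_i (rho a : 'M_(n + m)) i j *: vw i = 0.
  by rewrite -act; apply: ax; case: (vwh j).
by apply/matrixP => i j; rewrite mxE; apply: (vwfree _ (z j)).
Qed.
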